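(* Let $L$ and $M$ be invertible $G$-lattices. Then $L\otimes_{\mathbb{Z}\langle G\rangle}M$ is an invertible $G$-lattice with inner product $\langle a,b\rangle=t(a\cdot\bar b)$, where $\cdot:(L\otimes_{\mathbb{Z}\langle G\rangle}M)\times(\bar L\otimes_{\mathbb{Z}\langle G\rangle}\bar M)\to\mathbb{Z}\langle G\rangle$ is the $\mathbb{Z}\langle G\rangle$-bilinear map with $(x\otimes v)\cdot(\bar y\otimes\bar w)=(x\cdot\bar y)(v\cdot\bar w)$ and $\overline{x\otimes v}=\bar x\otimes\bar v$; moreover this dot product equals the lifted inner product of this $G$-lattice.
   Context: Let $G$ be a finite abelian group with a fixed element $u$ of order $2$, $n=\#G/2$, and $\mathbb{Z}\langle G\rangle=\mathbb{Z}[G]/(u+1)$, with scaled trace $t(\sum a_\sigma\sigma)=a_1-a_u$ and involution $\overline{\sum a_\sigma\sigma}=\sum a_\sigma\sigma^{-1}$. A lattice is a finitely generated abelian group with a bilinear, symmetric, positive definite $\mathbb{Z}$-valued form; unimodular means Gram determinant $1$. A $G$-lattice is a lattice with a homomorphism from $G$ to its form-preserving automorphisms in which $u$ acts as $-1$ (hence a $\mathbb{Z}\langle G\rangle$-module). A $G$-lattice $L$ is invertible if it has rank $n$, is unimodular, and for every $m\in\mathbb{Z}_{>0}$ there is $e_m\in L$ such that $\{\sigma e_m+mL:\sigma\in G\}$ generates $L/mL$ as an abelian group. For a $G$-lattice $L$, $\bar L$ is a copy of $L$ via $x\mapsto\bar x$ with $G$-action $\sigma\bar x=\overline{\sigma^{-1}x}$;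 the lifted inner product is $x\cdot\bar y=\sum_{\sigma\in S}\langle x,\sigma y\rangle\sigma\in\mathbb{Z}\langle G\rangle$ for any set $S$ of coset representatives of $G/\langle u\rangle$. The $G$-action on $L\otimes_{\mathbb{Z}\langle G\rangle}M$ is via its $\mathbb{Z}\langle G\rangle$-module structure. *)

(* Defs.v *)
From HB Require Import structures.
From mathcomp Require Import all_boot all_order fingroup all_algebra.
From mathcomp Require Import boolp.
From mathcomp Require Import generic_quotient freeg.

Set Implicit Arguments.
Unset Strict Implicit.
Unset Printing Implicit Defensive.

Import GRing.Theory Num.Theory.

Local Open Scope ring_scope.
Local Open Scope quotient_scope.

(* The tensor product is the free abelian group on U * V modulo the subgroup
   generated by the usual relators. *)
Section Tensor.
Variables (R : comNzRingType) (U V : lmodType R).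

Local Notation F := {freeg (U * V)%type / int}.

Definition fgen (x : U) (v : V) : F := Freeg [:: (1, (x, v))].

Inductive tensor_relators : F -> Prop :=
| TensorRel0 : tensor_relators 0
| TensorRelB z1 z2 :
    tensor_relators z1 -> tensor_relators z2 -> tensor_relators (z1 - z2)
| TensorRelDl x y v :
    tensor_relators (fgen (x + y) v - fgen x v - fgen y v)
| TensorRelDr x v w :
    tensor_relators (fgen x (v + w) - fgen x v - fgen x w)
| TensorRelZ a x v :
    tensor_relators (fgen (a *: x) v - fgen x (a *: v)).

Definition tensor_ker : {pred F} := fun z => `[< tensor_relators z >].

Lemma tensor_kerP z : reflect (tensor_relators z) (z \in tensor_ker).
Proof. exact: asboolP. Qed.

Lemma tensor_ker_zmod_closed : zmod_closed tensor_ker.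
Proof.
split; first exact/tensor_kerP/TensorRel0.
by move=> z1 z2 /tensor_kerP h1 /tensor_kerP h2; apply/tensor_kerP/TensorRelB.
Qed.

HB.instance Definition _ := GRing.isZmodClosed.Build F tensor_ker
  tensor_ker_zmod_closed.

Definition tensor := Quotient.quot tensor_ker.

HB.instance Definition _ := Choice.on tensor.
HB.instance Definition _ : EqQuotient F (Quotient.equiv tensor_ker) tensor :=
  EqQuotient.on tensor.
HB.instance Definition _ := GRing.Zmodule.on tensor.
HB.instance Definition _ :
  isZmodQuotient F (Quotient.equiv tensor_ker) 0 -%R +%R tensor :=
  ZmodQuotient.on tensor.

Definition tens (x : U) (v : V) : tensor := \pi_tensor (fgen x v).

Lemma pi_tensorP (z1 z2 : F) :
  reflect (tensor_relators (z1 - z2)) (\pi_tensor z1 == \pi_tensor z2).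
Proof. by rewrite -Quotient.idealrBE; apply: tensor_kerP. Qed.

Lemma pi_tensor_gen (z : F) :
  \pi_tensor z =
  \sum_(p <- dom z) tens p.1 p.2 *~ coeff p z.
Proof.
rewrite -[in LHS](freeg_sumE z) raddf_sum /=; apply: eq_bigr => -[x v] _.
by rewrite /tens /fgen -raddfMz /= freeg_mulz intz.
Qed.

Lemma tensDl x y v : tens (x + y) v = tens x v + tens y v.
Proof.
rewrite /tens -raddfD; apply/eqP/pi_tensorP.
by rewrite opprD addrA; apply: TensorRelDl.
Qed.

Lemma tensDr x v w : tens x (v + w) = tens x v + tens x w.
Proof.
rewrite /tens -raddfD; apply/eqP/pi_tensorP.
by rewrite opprD addrA; apply: TensorRelDr.
Qed.

Lemma tensZ a x v : tens (a *: x) v = tens x (a *: v).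
Proof. by apply/eqP/pi_tensorP; apply: TensorRelZ. Qed.

Lemma tensor_ind (P : tensor -> Prop) :
  P 0 -> (forall a b, P a -> P b -> P (a - b)) ->
  (forall x v, P (tens x v)) -> forall a, P a.
Proof.
move=> P0 PB Pt a; rewrite -[a]reprK pi_tensor_gen.
have PN b : P b -> P (- b) by move=> Pb; rewrite -[- b]add0r; apply: PB.
have PD b c : P b -> P c -> P (b + c).
  by move=> Pb Pc; rewrite -[c]opprK; apply: PB => //; apply: PN.
have Pn n b : P b -> P (b *+ n).
  by move=> Pb; elim: n => [|n IHn]; rewrite ?mulr0n // mulrS; apply: PD.
elim/big_ind: _ => // -[x v] _; case: (coeff _ _) => n.
  exact/Pn/Pt.
by rewrite NegzE mulrNz; apply/PN/(Pn n.+1)/Pt.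
Qed.

Definition fscale (a : R) (z : F) : F :=
  fglift (fun p => fgen (a *: p.1) p.2) z.

Lemma fscaleB a : {morph fscale a : z1 z2 / z1 - z2}.
Proof. exact: lift_is_additive. Qed.

Lemma fscale_gen a x v : fscale a (fgen x v) = fgen (a *: x) v.
Proof. by rewrite /fscale /fgen liftU scale1r. Qed.

Lemma fscale_relators a z : tensor_relators z -> tensor_relators (fscale a z).
Proof.
elim=> {z} [|z1 z2 _ h1 _ h2|x y v|x v w|b x v].
- by rewrite -(subrr 0) fscaleB subrr; apply: TensorRel0.
- by rewrite fscaleB; apply: TensorRelB.
- by rewrite !fscaleB !fscale_gen scalerDr; apply: TensorRelDl.
- by rewrite !fscaleB !fscale_gen; apply: TensorRelDr.
- rewrite !fscaleB !fscale_gen scalerA mulrC -scalerA; exact: TensorRelZ.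
Qed.

Definition tensor_scale (a : R) (z : tensor) : tensor :=
  \pi_tensor (fscale a (repr z)).

Lemma pi_fscale a z : tensor_scale a (\pi_tensor z) = \pi_tensor (fscale a z).
Proof.
apply/eqP/pi_tensorP; rewrite -fscaleB; apply: fscale_relators.
by apply/pi_tensorP; rewrite reprK.
Qed.

Lemma tensor_scaleB a : {morph tensor_scale a : z1 z2 / z1 - z2}.
Proof.
move=> z1 z2; rewrite -[z1]reprK -[z2]reprK -raddfB /= !pi_fscale fscaleB.
exact: raddfB.
Qed.

Lemma tensor_scale_tens a x v : tensor_scale a (tens x v) = tens (a *: x) v.
Proof. by rewrite pi_fscale fscale_gen. Qed.

Lemma tensor_scale0 a : tensor_scale a 0 = 0.
Proof. by rewrite -(subrr 0) tensor_scaleB !subrr. Qed.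

Lemma tensor_scaleA a b z :
  tensor_scale a (tensor_scale b z) = tensor_scale (a * b) z.
Proof.
elim/tensor_ind: z => [|z1 z2 h1 h2|x v].
- by rewrite !tensor_scale0.
- by rewrite !tensor_scaleB h1 h2.
- by rewrite !tensor_scale_tens scalerA.
Qed.

Lemma tensor_scale1 : left_id 1 tensor_scale.
Proof.
elim/tensor_ind => [|z1 z2 h1 h2|x v].
- by rewrite tensor_scale0.
- by rewrite tensor_scaleB h1 h2.
- by rewrite tensor_scale_tens scale1r.
Qed.

Lemma tensor_scaleDr : right_distributive tensor_scale +%R.
Proof.
move=> a z1 z2; have scaleN z : tensor_scale a (- z) = - tensor_scale a z.
  by rewrite -[- z]add0r tensor_scaleB tensor_scale0 add0r.
by rewrite -{1}[z2]opprK tensor_scaleB scaleN opprK.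
Qed.

Lemma tensor_scaleDl z : {morph tensor_scale^~ z : a b / a + b}.
Proof.
move=> a b; elim/tensor_ind: z => [|z1 z2 h1 h2|x v].
- by rewrite !tensor_scale0 addr0.
- by rewrite !tensor_scaleB h1 h2 opprD addrACA.
- by rewrite !tensor_scale_tens scalerDl tensDl.
Qed.

HB.instance Definition _ := GRing.Zmodule_isLmodule.Build R tensor
  tensor_scaleA tensor_scale1 tensor_scaleDr tensor_scaleDl.

Lemma tensZl a x v : a *: tens x v = tens (a *: x) v.
Proof. exact: tensor_scale_tens. Qed.

End Tensor.

Record ugroup := UGroup {
  ug_gT :> finGroupType;
  ug_abelian : abelian [set: ug_gT];
  ug_u : ug_gT;
  ug_order : #[ug_u]%g = 2%N
}.

Section GroupRing.
Variable G : ugroup.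

Local Notation u := (ug_u G).

Definition group_ring := {ffun G -> int}.

HB.instance Definition _ := GRing.Zmodule.on group_ring.

Implicit Types (a b c : group_ring) (g h : G).

Lemma ugC g h : (g * h = h * g)%g.
Proof. by have /centsP -> := ug_abelian G; rewrite ?inE. Qed.

Lemma uK : (u * u = 1)%g.
Proof. by rewrite -expg2 -(ug_order G) expg_order. Qed.

Lemma u_neq1 : u != 1%g.
Proof. by rewrite -order_gt1 ug_order. Qed.

Definition gr_delta g : group_ring := [ffun h => (h == g)%:R].

Definition gr_mul a b : group_ring :=
  [ffun g => \sum_h a h * b (h^-1 * g)%g].

Lemma gr_mulC : commutative gr_mul.
Proof.
move=> a b; apply/ffunP => g; rewrite !ffunE.
rewrite (reindex_inj (h := fun h => (g * h^-1)%g)) /=; last first.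
  by move=> h k /mulgI/invg_inj.
apply: eq_bigr => h _; rewrite mulrC invMg invgK mulgKV.
by rewrite [(g * _)%g]ugC.
Qed.

Lemma gr_mulA : associative gr_mul.
Proof.
move=> a b c; apply/ffunP => g; rewrite !ffunE.
under eq_bigr do rewrite ffunE mulr_sumr.
under [RHS]eq_bigr do rewrite ffunE mulr_suml.
rewrite [RHS]exchange_big /=; apply: eq_bigr => h _.
rewrite [RHS](reindex_inj (mulgI h)) /=; apply: eq_bigr => k _.
by rewrite mulKg mulrA invMg mulgA.
Qed.

Lemma gr_mul1 : left_id (gr_delta 1%g) gr_mul.
Proof.
move=> a; apply/ffunP => g; rewrite ffunE (bigD1 1%g) //= ffunE eqxx mul1r.
rewrite invg1 mul1g big1 ?addr0 // => h /negPf nh.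
by rewrite ffunE nh mul0r.
Qed.

Lemma gr_mulDl : left_distributive gr_mul +%R.
Proof.
move=> a b c; apply/ffunP => g; rewrite !ffunE -big_split /=.
by apply: eq_bigr => h _; rewrite ffunE mulrDl.
Qed.

Lemma gr_delta1_neq0 : gr_delta 1%g != 0.
Proof. by apply/eqP => /ffunP /(_ 1%g); rewrite !ffunE eqxx. Qed.

HB.instance Definition _ := GRing.Zmodule_isComNzRing.Build group_ring
  gr_mulA gr_mulC gr_mul1 gr_mulDl gr_delta1_neq0.

Lemma gr_mul_delta a h g : (a * gr_delta h : group_ring) g = a (g * h^-1)%g.
Proof.
rewrite [a * _]mulrC ffunE (bigD1 h) //= ffunE eqxx mul1r.
rewrite big1 ?addr0 1?ugC // => k /negPf nk.
by rewrite ffunE nk mul0r.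
Qed.

Definition u1_ideal : {pred group_ring} :=
  fun a => `[< exists b : group_ring, a = b * (gr_delta u + 1) >].

Lemma u1_idealP a :
  reflect (exists b : group_ring, a = b * (gr_delta u + 1)) (a \in u1_ideal).
Proof. exact: asboolP. Qed.

Definition gr_trace a : int := a 1%g - a u.

Lemma gr_traceB : {morph gr_trace : a b / a - b}.
Proof. by move=> a b; rewrite /gr_trace !ffunE opprD addrACA opprD. Qed.

Lemma u1_ideal_sym a g :
  a \in u1_ideal -> a (g * u)%g = a g.
Proof.
have uV : (u^-1 = u)%g by apply/eqP; rewrite eq_invg_mul uK.
have addE a1 a2 h : (a1 + a2 : group_ring) h = a1 h + a2 h by rewrite ffunE.
move=> /u1_idealP [b ->]; rewrite mulrDr mulr1 !addE.
by rewrite !gr_mul_delta uV -mulgA uK mulg1 addrC.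
Qed.

Lemma gr_trace_ideal a : a \in u1_ideal -> gr_trace a = 0.
Proof.
by move=> /(u1_ideal_sym 1%g); rewrite mul1g /gr_trace => ->; rewrite subrr.
Qed.

Lemma u1_ideal_closed : idealr_closed u1_ideal.
Proof.
split; first by apply/u1_idealP; exists 0; rewrite mul0r.
  apply/negP => /gr_trace_ideal; rewrite /gr_trace !ffunE eqxx.
  by rewrite (negPf u_neq1).
move=> a x y /u1_idealP [b ->] /u1_idealP [c ->]; apply/u1_idealP.
by exists (a * b + c); rewrite mulrDl mulrA.
Qed.

HB.instance Definition _ := isIdealr.Build group_ring u1_ideal u1_ideal_closed.

(* Z[G]/(u+1) *)
Definition ZG := {ideal_quot u1_ideal}.

HB.instance Definition _ := Choice.on ZG.
HB.instance Definition _ :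
  EqQuotient group_ring (Quotient.equiv u1_ideal) ZG := EqQuotient.on ZG.
HB.instance Definition _ := GRing.ComNzRing.on ZG.
HB.instance Definition _ :
  isZmodQuotient group_ring (Quotient.equiv u1_ideal) 0 -%R +%R ZG :=
  ZmodQuotient.on ZG.
HB.instance Definition _ :
  isNzRingQuotient group_ring (Quotient.equiv u1_ideal) 0 -%R +%R 1 *%R ZG :=
  NzRingQuotient.on ZG.

Lemma pi_ZGP a b : reflect (a - b \in u1_ideal) (\pi_ZG a == \pi_ZG b).
Proof. by rewrite -Quotient.idealrBE; apply: idP. Qed.

Definition zg (g : G) : ZG := \pi_ZG (gr_delta g).

(* Independent of the representative, see [scaled_trace_pi]. *)
Definition scaled_trace (z : ZG) : int := gr_trace (repr z).

Lemma scaled_trace_pi a : scaled_trace (\pi_ZG a) = gr_trace a.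
Proof.
apply/eqP; rewrite -subr_eq0 -gr_traceB; apply/eqP/gr_trace_ideal.
by apply/pi_ZGP; rewrite reprK.
Qed.

End GroupRing.

Section Lattices.
Variables (V : zmodType) (form : V -> V -> int).

Definition finitely_generated :=
  exists (m : nat) (s : m.-tuple V), forall x, inIntSpan s x.

Record is_lattice : Prop := IsLattice {
  lattice_fg : finitely_generated;
  lattice_formDl : forall z, {morph form^~ z : x y / x + y};
  lattice_formDr : forall z, {morph form z : x y / x + y};
  lattice_formC : forall x y, form x y = form y x;
  lattice_pos : forall x, x != 0 -> 0 < form x x
}.

Definition zbasis m (b : m.-tuple V) :=
  (forall x, inIntSpan b x) /\
  (forall c : int ^ m, \sum_(i < m) b`_i *~ c i = 0 -> forall i, c i = 0).

Definition has_rank m := exists b : m.-tuple V, zbasis b.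

Definition gram m (b : m.-tuple V) : 'M[int]_m :=
  \matrix_(i, j) form b`_i b`_j.

(* The Gram determinant does not depend on the basis. *)
Definition unimodular :=
  exists (m : nat) (b : m.-tuple V), zbasis b /\ \det (gram b) = 1.

End Lattices.

Record is_glattice (G : ugroup) (V : zmodType)
    (form : V -> V -> int) (act : G -> V -> V) : Prop := IsGLattice {
  glattice_lattice : is_lattice form;
  glattice_actD : forall s, {morph act s : x y / x + y};
  glattice_act_form : forall s x y, form (act s x) (act s y) = form x y;
  glattice_act1 : forall x, act 1%g x = x;
  glattice_actM : forall s r x, act (s * r)%g x = act s (act r x);
  glattice_actu : forall x, act (ug_u G) x = - x
}.

Record glattice (G : ugroup) := GLattice {
  gl_sort : zmodType;
  gl_form : gl_sort -> gl_sort -> int;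
  gl_act : G -> gl_sort -> gl_sort;
  gl_ax : is_glattice gl_form gl_act
}.

Definition gl_carrier (G : ugroup) (L : glattice G) : Type := gl_sort L.
Coercion gl_carrier : glattice >-> Sortclass.

Section GLattice.
Variables (G : ugroup) (L : glattice G).

Local Notation u := (ug_u G).

HB.instance Definition _ := GRing.Zmodule.on (gl_carrier L).

Definition ip (x y : L) : int := gl_form x y.
Definition gact (s : G) (x : L) : L := gl_act s x.

(* The last condition says that the classes of the [gact s e] generate L/mL. *)
Definition invertible :=
  [/\ has_rank L (#|G| %/ 2),
      unimodular ip &
      forall m : nat, (0 < m)%N -> exists e : L, forall x : L,
        exists (c : G -> int) (y : L), x = \sum_s gact s e *~ c s + y *+ m].

Lemma gactD s : {morph gact s : x y / x + y}.
Proof. exact: glattice_actD (gl_ax L) s. Qed.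

Lemma gact1 x : gact 1%g x = x.
Proof. exact: glattice_act1 (gl_ax L) x. Qed.

Lemma gactM s r x : gact (s * r)%g x = gact s (gact r x).
Proof. exact: glattice_actM (gl_ax L) s r x. Qed.

Lemma gactu x : gact u x = - x.
Proof. exact: glattice_actu (gl_ax L) x. Qed.

Fact gact_is_zmod_morphism s : zmod_morphism (gact s).
Proof.
move=> x y; apply: (addIr (gact s y)).
by rewrite -gactD !subrK.
Qed.

HB.instance Definition _ s := GRing.isZmodMorphism.Build L L (gact s)
  (gact_is_zmod_morphism s).

Definition gr_scale (a : group_ring G) (x : L) : L := \sum_s gact s x *~ a s.

Lemma gr_scaleDl a b x : gr_scale (a + b) x = gr_scale a x + gr_scale b x.
Proof.
by rewrite -big_split; apply: eq_bigr => s _; rewrite ffunE mulrzDr.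
Qed.

Lemma gr_scaleDr a x y : gr_scale a (x + y) = gr_scale a x + gr_scale a y.
Proof.
by rewrite -big_split; apply: eq_bigr => s _; rewrite raddfD mulrzDl.
Qed.

Lemma gr_scale_delta g x : gr_scale (gr_delta g) x = gact g x.
Proof.
rewrite /gr_scale (bigD1 g) //= ffunE eqxx mulr1z big1 ?addr0 // => s /negPf ns.
by rewrite ffunE ns mulr0z.
Qed.

Lemma gr_scaleA a b x : gr_scale a (gr_scale b x) = gr_scale (a * b) x.
Proof.
rewrite /gr_scale.
under [RHS]eq_bigr do rewrite ffunE mulrz_sumr.
rewrite [RHS]exchange_big /=; apply: eq_bigr => s _.
rewrite [RHS](reindex_inj (mulgI s)) /= raddf_sum mulrz_suml.
apply: eq_bigr => r _; rewrite mulKg gactM raddfMz /=.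
by rewrite -mulrzA mulrC.
Qed.

Lemma gr_scale_ideal a x : a \in @u1_ideal G -> gr_scale a x = 0.
Proof.
move=> /u1_idealP [b ->]; rewrite -gr_scaleA gr_scaleDl !gr_scale_delta.
rewrite gactu gact1 addNr /gr_scale big1 // => s _.
by rewrite raddf0 mul0rz.
Qed.

Definition ZG_scale (z : ZG G) (x : L) : L := gr_scale (repr z) x.

Lemma ZG_scale_pi a x : ZG_scale (\pi_(ZG G) a) x = gr_scale a x.
Proof.
have : repr (\pi_(ZG G) a) - a \in @u1_ideal G by apply/pi_ZGP; rewrite reprK.
move=> /(gr_scale_ideal x) h; rewrite /ZG_scale.
by rewrite -[X in gr_scale X x](subrK a) gr_scaleDl h add0r.
Qed.

Lemma ZG_scaleA z1 z2 x : ZG_scale z1 (ZG_scale z2 x) = ZG_scale (z1 * z2) x.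
Proof.
rewrite -[z1]reprK -[z2]reprK -rmorphM /= !ZG_scale_pi.
exact: gr_scaleA.
Qed.

Lemma ZG_scale1 : left_id 1 ZG_scale.
Proof.
move=> x; rewrite -(rmorph1 \pi_(ZG G)) /= ZG_scale_pi.
by rewrite gr_scale_delta gact1.
Qed.

Lemma ZG_scaleDr : right_distributive ZG_scale +%R.
Proof. by move=> z x y; apply: gr_scaleDr. Qed.

Lemma ZG_scaleDl x : {morph ZG_scale^~ x : z1 z2 / z1 + z2}.
Proof.
move=> z1 z2; rewrite -[z1]reprK -[z2]reprK -raddfD /= !ZG_scale_pi.
exact: gr_scaleDl.
Qed.

HB.instance Definition _ := GRing.Zmodule_isLmodule.Build (ZG G) (gl_carrier L)
  ZG_scaleA ZG_scale1 ZG_scaleDr ZG_scaleDl.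

Lemma zg_scale g x : zg g *: x = gact g x.
Proof. by rewrite [LHS]ZG_scale_pi gr_scale_delta. Qed.

(* The conjugate lattice has the same carrier and form; only the action
   changes. *)
Lemma conj_is_glattice :
  is_glattice (@gl_form G L) (fun s x => gl_act s^-1%g x).
Proof.
have [lL aD af a1 aM au] := gl_ax L; split=> //.
- by move=> x; rewrite invg1.
- by move=> s r x; rewrite invMg ugC.
- have -> // : ((ug_u G)^-1 = ug_u G)%g by apply/eqP; rewrite eq_invg_mul uK.
Qed.

Definition conj_glattice : glattice G := GLattice conj_is_glattice.

Definition conjv (x : L) : conj_glattice := x.
Definition unconjv (x : conj_glattice) : L := x.

Definition coset_reps (S : {set G}) :=
  is_transversal S (rcosets <[u]> [set: G]) [set: G].

Definition lifted_ip_on (S : {set G}) (x : L) (y : conj_glattice) : ZG G :=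
  \sum_(s in S) zg s *~ ip x (gact s (unconjv y)).

(* Any other set of coset representatives gives the same value, see
   [lifted_ip_indep]. *)
Definition lifted_ip :=
  lifted_ip_on (transversal (rcosets <[u]> [set: G]) [set: G]).

Lemma zgu s : zg (u * s)%g = - zg s.
Proof.
apply/eqP; rewrite /zg -raddfN; apply/pi_ZGP/u1_idealP.
exists (gr_delta s); rewrite mulrDr mulr1 opprK; congr (_ + _).
apply/ffunP => g; rewrite gr_mul_delta !ffunE.
by rewrite ugC -(inj_eq (mulIg u^-1%g)) mulgK.
Qed.

Lemma ipNr x y : ip x (- y) = - ip x y.
Proof.
have [[_ _ D _ _] _ _ _ _ _] := gl_ax L.
have ip0 : ip x 0 = 0.
  by apply: (addrI (ip x 0)); rewrite -[X in X = _](D x) !addr0.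
by apply: (addrI (ip x y)); rewrite -[X in X = _](D x) !subrr.
Qed.

Lemma lifted_ip_indep S x y :
  coset_reps S -> lifted_ip_on S x y = lifted_ip x y.
Proof.
pose P := rcosets <[u]> [set: G].
have partP : partition P [set: G] by apply: rcosets_partition; apply: subsetT.
pose F s : ZG G := zg s *~ ip x (gact s (unconjv y)).
have Fu s : F (u * s)%g = F s.
  by rewrite /F zgu gactM gactu ipNr mulrNz mulNrz opprK.
have FP B s r : B \in P -> s \in B -> r \in B -> F s = F r.
  have Fcoset g s' : s' \in (<[u]> :* g)%g -> F s' = F g.
    case/rcosetP => _ /cycleP [k ->] ->; elim: k => [|k IHk].
      by rewrite expg0 mul1g.
    by rewrite expgS -mulgA Fu.
  by case/rcosetsP => g _ -> /Fcoset -> /Fcoset ->.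
have sumP T : is_transversal T P [set: G] ->
    \sum_(s in T) F s = \sum_(B in P) F (transversal_repr 1%g T B).
  move=> trT; rewrite -{1}(im_transversal_repr trT 1%g) big_imset //.
  exact: can_in_inj (transversal_reprK trT 1%g).
move=> trS; have trT := transversalP partP.
rewrite /lifted_ip /lifted_ip_on (sumP _ trS) (sumP _ trT).
apply: eq_bigr => B PB.
apply: (FP B) => //; [exact: repr_mem_pblock trS _ _ PB | exact: repr_mem_pblock trT _ _ PB].
Qed.

End GLattice.

Arguments invertible {G} L.
Arguments conj_glattice {G} L.
Arguments conjv {G L} x.
Arguments lifted_ip {G L} x y.

Notation "L *t M" := (tensor (gl_carrier L) (gl_carrier M))
  (at level 40, left associativity) : type_scope.

Section TensorGLattice.
Variables (G : ugroup) (L M : glattice G).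

Definition is_tensor_dot
    (dot : (L *t M)%type -> (conj_glattice L *t conj_glattice M)%type -> ZG G) :=
  [/\ forall b, scalar (dot^~ b),
      forall a, scalar (dot a) &
      forall (x y : L) (v w : M),
        dot (tens x v) (tens (conjv y) (conjv w)) =
        lifted_ip x (conjv y) * lifted_ip v (conjv w)].

(* The identification of the conjugate of L (x) M with the tensor product of the
   conjugates. *)
Definition is_tensor_conj
    (bar : (L *t M)%type -> (conj_glattice L *t conj_glattice M)%type) :=
  {morph bar : a b / a + b} /\
  forall (x : L) (v : M), bar (tens x v) = tens (conjv x) (conjv v).

End TensorGLattice.

(* Main.v *)
Require Import Defs.
From HB Require Import structures.
From mathcomp Require Import all_boot all_order fingroup all_algebra.
From mathcomp Require Import boolp generic_quotient freeg ring.

Set Implicit Arguments.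
Unset Strict Implicit.
Unset Printing Implicit Defensive.

Import Order.TTheory GRing.Theory Num.Theory.

Local Open Scope ring_scope.
Local Open Scope quotient_scope.

(** Write R for Z<G>, t for the scaled trace and [hip x y] for the lifted inner
    product of x and the conjugate of y; it is the unique element of R with
    t(z [hip x y]) = <z x, y> for all z.  Since L/mL is cyclic for every m, an
    invertible L satisfies the rank one identity
    [hip x y *: x' = hip x' y *: x], and since moreover L is unimodular of rank
    n, there are x_i, y_i with [hip x1 y1 + hip x2 y2 = 1].
    For w in M, contraction sends x (x) v to [hip v w *: x].  An orthogonal basis
    (w_j) of M over the rationals and the rank one identity express a positive
    multiple of <a, a> as a sum of the <c_j a, c_j a> with positive weights,
    where c_j is contraction with w_j, so the form on L (x) M is positive
    definite.  Hence L (x) M is free over Z; its rank is found by comparison with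
    the R-span of one pure tensor, and the elements x_i, y_i of L and M show that
    every functional is represented by the form, so that the Gram determinant is
    a unit. *)

(** * Additive maps given by an unbundled morphism property *)

Section AdditiveMaps.
Variables (U W : zmodType) (f : U -> W).
Hypothesis fD : {morph f : x y / x + y}.

Lemma morphD_zmod : zmod_morphism f.
Proof. by move=> x y; apply: (addIr (f y)); rewrite -fD !subrK. Qed.

Let h : {additive U -> W} :=
  HB.pack f (GRing.isZmodMorphism.Build U W f morphD_zmod).

Lemma morphD0 : f 0 = 0. Proof. exact: (raddf0 h). Qed.
Lemma morphDN x : f (- x) = - f x. Proof. exact: (raddfN h). Qed.
Lemma morphDMn x n : f (x *+ n) = f x *+ n. Proof. exact: (raddfMn h). Qed.
Lemma morphDMz x n : f (x *~ n) = f x *~ n. Proof. exact: (raddfMz h). Qed.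

Lemma morphD_sum (I : Type) (r : seq I) (P : pred I) (F : I -> U) :
  f (\sum_(i <- r | P i) F i) = \sum_(i <- r | P i) f (F i).
Proof. exact: (raddf_sum h). Qed.

End AdditiveMaps.

(** * Integer matrices: congruences of determinants and a rank bound *)

Section IntMatrices.

Lemma mxMzE m n (A : 'M[int]_(m, n)) k i j : (A *~ k) i j = A i j * k.
Proof.
rewrite -mulrzz; apply: (morphDMz (f := fun B : 'M[int]_(m, n) => B i j)).
by move=> B C; rewrite mxE.
Qed.

(** The Leibniz expansion is an integer polynomial in the entries, so it respects congruences; used
    to compare matrices modulo m. *)
Lemma dvdz_sub_det n (d : int) (A B : 'M[int]_n) :
  (forall i j, (d %| A i j - B i j)%Z) -> (d %| \det A - \det B)%Z.
Proof.
move=> AB; rewrite /determinant -sumrB; apply: rpred_sum => s _.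
rewrite -mulrBr; rewrite dvdz_mull //.
apply: (big_ind2 (fun a b : int => (d %| a - b)%Z)) => //.
move=> x1 x2 y1 y2 h1 h2.
have -> : x1 * y1 - x2 * y2 = (x1 - x2) * y1 + x2 * (y1 - y2) by ring.
by rewrite rpredD //; [rewrite dvdz_mulr | rewrite dvdz_mull].
Qed.

(** Over the rationals the product has rank m, yet it factors through a space of dimension n. All
    rank comparisons rest on this bound. *)
Lemma det_mul_neq0_leq m n (A : 'M[int]_(m, n)) (B : 'M[int]_(n, m)) :
  \det (A *m B) != 0 -> (m <= n)%N.
Proof.
move=> dAB; pose q := map_mx (intr : int -> rat).
have uAB : q _ _ A *m q _ _ B \in unitmx.
  by rewrite -map_mxM unitmxE det_map_mx unitfE intr_eq0.
have := mxrank_unit uAB => rk; rewrite -rk.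
exact: leq_trans (mxrankM_maxl _ _) (rank_leq_col _).
Qed.

End IntMatrices.

(** * Coordinates and sizes of integral bases *)

Section Bases.
Variable V : zmodType.

Lemma zbasis_coord m (b : m.-tuple V) : zbasis b ->
  exists crd : V -> 'rV[int]_m,
    [/\ {morph crd : x y / x + y},
        forall x, x = \sum_(i < m) b`_i *~ crd x 0 i &
        forall i j : 'I_m, crd b`_i 0 j = (i == j)%:R].
Proof.
move=> [bspan bfree].
have /choice [crd crdP] : forall x, exists c : 'rV[int]_m, x = \sum_(i < m) b`_i *~ c 0 i.
  move=> x; have [a ->] := bspan x; exists (\row_i a i).
  by apply: eq_bigr => i _; rewrite mxE.
have uniq (c d : 'rV[int]_m) :
    \sum_(i < m) b`_i *~ c 0 i = \sum_(i < m) b`_i *~ d 0 i -> c = d.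
  move=> cd; apply/rowP => i; apply/eqP; rewrite -subr_eq0; apply/eqP.
  have := bfree [ffun i => c 0 i - d 0 i]; rewrite (eq_bigr (fun i : 'I_m =>
    b`_i *~ c 0 i - b`_i *~ d 0 i)) => [|k _]; last by rewrite ffunE mulrzBr.
  by rewrite sumrB cd subrr => /(_ erefl i); rewrite ffunE.
exists crd; split=> //.
- move=> x y; apply: uniq; rewrite -crdP {1}(crdP x) {1}(crdP y) -big_split.
  by apply: eq_bigr => i _; rewrite mxE mulrzDr.
- move=> i j; suff -> : crd b`_i = delta_mx 0 i by rewrite mxE eqxx eq_sym.
  apply: uniq; rewrite -crdP (bigD1 i) //= mxE !eqxx big1 ?addr0 // => k ki.
  by rewrite mxE (negPf ki) andbF mulr0z.
Qed.

Lemma zbasis_size m n (b : m.-tuple V) (c : n.-tuple V) :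
  zbasis b -> zbasis c -> m = n.
Proof.
suff le p q (b' : p.-tuple V) (c' : q.-tuple V) :
    zbasis b' -> zbasis c' -> (p <= q)%N.
  by move=> Zb Zc; apply/eqP; rewrite eqn_leq (le _ _ _ _ Zb Zc) (le _ _ _ _ Zc Zb).
move=> /zbasis_coord [f [fD fE fb]] /zbasis_coord [g [gD gE gb]].
pose A : 'M[int]_(p, q) := \matrix_(i, j) g b'`_i 0 j.
pose B : 'M[int]_(q, p) := \matrix_(i, j) f c'`_i 0 j.
suff AB : A *m B = 1%:M by apply: (@det_mul_neq0_leq _ _ A B); rewrite AB det1.
apply/matrixP => i j; rewrite mxE [RHS]mxE -fb [in RHS](gE b'`_i) (morphD_sum fD) summxE.
apply: eq_bigr => k _; by rewrite (morphDMz fD) mxMzE !mxE mulrC.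
Qed.

End Bases.

(** * Positive definite integral lattices *)

Section LatticeTheory.
Variables (V : zmodType) (form : V -> V -> int).
Hypothesis latV : is_lattice form.

Let formDl z : {morph form^~ z : x y / x + y}. Proof. exact: lattice_formDl latV z. Qed.
Let formDr z : {morph form z : x y / x + y}. Proof. exact: lattice_formDr latV z. Qed.
Let formC x y : form x y = form y x. Proof. exact: lattice_formC latV x y. Qed.

Lemma lattice_eq0 x : form x x = 0 -> x = 0.
Proof.
move=> xx0; apply/eqP/negPn/negP => /(lattice_pos latV).
by rewrite xx0 ltxx.
Qed.

Lemma lattice_ge0 x : 0 <= form x x.
Proof.
have [->|/(lattice_pos latV)/ltW //] := eqVneq x 0.
by rewrite (morphD0 (formDr _)).
Qed.

Lemma lattice_torsion_free (x : V) (k : int) : k != 0 -> x *~ k = 0 -> x = 0.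
Proof.
move=> k0 xk0; apply: lattice_eq0; apply/eqP.
have := morphD0 (formDr x); rewrite -xk0 (morphDMz (formDr x)) mulrzz => /eqP.
by rewrite mulf_eq0 (negPf k0) orbF.
Qed.

(** Taking m = <x, x> + 1, divisibility of x by m forces m to divide the smaller number <x, x>,
    which is therefore 0. *)
Lemma lattice_divisible_eq0 (x : V) :
  (forall m : nat, (0 < m)%N -> exists y, x = y *+ m) -> x = 0.
Proof.
move=> divx; apply: lattice_eq0; have [y xy] := divx `|form x x|.+1 isT.
have : form x x = form x y *+ `|form x x|.+1.
  by rewrite -(morphDMn (formDr x)) -xy.
move: (form x x) (form x y) => a b; rewrite -mulr_natr natz => ab.
have : (`|a|.+1 %| `|a|)%N by rewrite {2}ab abszM dvdn_mull.
by case: (posnP `|a|%N) => [/eqP|a0 /(dvdn_leq a0)]; [rewrite absz_eq0 => /eqP | rewrite ltnn].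
Qed.

Lemma form_sum_l (I : Type) (r : seq I) (P : pred I) (F : I -> V) (c : I -> int) y :
  form (\sum_(i <- r | P i) F i *~ c i) y = \sum_(i <- r | P i) form (F i) y * c i.
Proof.
rewrite (morphD_sum (formDl y)); apply: eq_bigr => i _.
by rewrite (morphDMz (formDl y)) mulrzz.
Qed.

Lemma form_sum_r (I : Type) (r : seq I) (P : pred I) (F : I -> V) (c : I -> int) x :
  form x (\sum_(i <- r | P i) F i *~ c i) = \sum_(i <- r | P i) form x (F i) * c i.
Proof. by rewrite formC form_sum_l; apply: eq_bigr => i _; rewrite formC. Qed.

(* Gram-Schmidt without denominators; a vector that becomes dependent is kept
   in the frame with weight 0, so that the frame has the size of [b]. *)
Lemma orthogonal_frame (b : seq V) :
  exists (D : int) (W : seq (int * V)),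
    [/\ 0 < D, size W = size b, forall p, p \in W -> 0 <= p.1 &
        forall v, v \in b ->
          v *~ D = \sum_(p <- W) p.2 *~ (p.1 * form v p.2)].
Proof.
pose pi W v : V := \sum_(p <- W) p.2 *~ (p.1 * form v p.2).
(* [pi W] is D times the orthogonal projection onto the span of [b]. The invariant on the frame
   vectors is added so that the next residual is orthogonal to them too. *)
suff [D [W [D0 sW cW bW _]]] : exists (D : int) (W : seq (int * V)),
    [/\ 0 < D, size W = size b, forall p, p \in W -> 0 <= p.1,
        forall v, v \in b -> v *~ D = pi W v &
        forall p, p \in W -> p.2 *~ D = pi W p.2].
  by exists D, W.
elim: b => [|x b [D [W [D0 sW cW bW oW]]]].
  by exists 1, [::]; split.
have piC v z : form (pi W v) z = form v (pi W z).
  rewrite form_sum_l form_sum_r; apply: eq_bigr => p _.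
  by rewrite (formC p.2 z); ring.
pose w := x *~ D - pi W x.
have worth v : v *~ D = pi W v -> form v w = 0.
  move=> vD; rewrite formDr (morphDN (formDr v)) -piC -vD.
  by rewrite (morphDMz (formDl x)) (morphDMz (formDr v)) subrr.
have [w0|w0] := eqVneq w 0.
  have xD : x *~ D = pi W x by apply/eqP; rewrite -subr_eq0 -/w w0.
  have piE v : pi ((0, 0) :: W) v = pi W v.
    by rewrite /pi big_cons /= mul0rz add0r.
  exists D, ((0, 0) :: W); split=> //=; first by rewrite sW.
  - by move=> p; rewrite inE => /predU1P [-> //|/cW].
  - by move=> v; rewrite piE inE => /predU1P [-> //|/bW].
  - move=> p; rewrite piE inE => /predU1P [->|/oW //] /=; rewrite mul0rz /pi.
    by rewrite big1 // => q _; rewrite (morphD0 (formDl _)) mulr0 mulr0z.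
pose d := form w w; have d0 : 0 < d := lattice_pos latV w0.
(* Multiplying [x *~ D = w + pi W x] by d and using D <x, w> = d gives [w] the weight D and
   multiplies the old weights by d; the common factor becomes D d. *)
pose W' := (D, w) :: [seq (p.1 * d, p.2) | p <- W].
have piE v : pi W' v = w *~ (D * form v w) + pi W v *~ d.
  rewrite /pi big_cons big_map /=; congr (_ + _).
  rewrite mulrz_suml; apply: eq_bigr => p _ /=; rewrite -mulrzA.
  by congr (_ *~ _); ring.
have fixE v : v *~ D = pi W v -> v *~ (D * d) = pi W' v.
  by move=> vD; rewrite piE (worth _ vD) mulr0 mulr0z add0r -vD mulrzA.
exists (D * d), W'; split; first by rewrite mulr_gt0.
- by rewrite /= size_map sW.
- move=> p; rewrite inE => /predU1P [-> /=|/mapP [q /cW q0 ->] /=].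
    exact: ltW.
  by rewrite mulr_ge0 // ltW.
- move=> v; rewrite inE => /predU1P [->|/bW /fixE //].
  rewrite piE; have -> : D * form x w = d.
    have pixw : form (pi W x) w = 0.
      rewrite form_sum_l big_seq big1 // => p pW.
      by rewrite (worth _ (oW _ pW)) mul0r.
    rewrite /d {2}/w formDl (morphDN (formDl w)) pixw subr0.
    by rewrite (morphDMz (formDl w)) mulrzz mulrC.
  by rewrite -mulrzDl subrK mulrzA.
- move=> p; rewrite inE => /predU1P [-> /=|/mapP [q /oW qW ->] /=]; last exact: fixE.
  rewrite piE; have -> : pi W w = 0.
    rewrite /pi big_seq big1 // => p' pW; rewrite formC.
    by rewrite (worth _ (oW _ pW)) mulr0 mulr0z.
  by rewrite mul0rz addr0.
Qed.

(** The frame writes D times the Gram matrix as B diag(c) B^T with c nonnegative. B is square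
    because the frame has the size of [b], so the determinant is a square times a product of
    weights. *)
Lemma det_gram_ge0 m (b : m.-tuple V) : 0 <= \det (gram form b).
Proof.
have [D [W [D0 sW cW bW]]] := orthogonal_frame b.
rewrite size_tuple in sW.
pose p0 : int * V := (0, 0).
pose B : 'M[int]_m := \matrix_(i, j) form b`_i (nth p0 W j).2.
pose c : 'rV[int]_m := \row_j (nth p0 W j).1.
have DG : D *: gram form b = B *m diag_mx c *m B^T.
  apply/matrixP => i j; rewrite !mxE.
  have bi : b`_i \in (b : seq V) by rewrite mem_nth // size_tuple.
  transitivity (form (b`_i *~ D) b`_j).
    by rewrite (morphDMz (formDl _)) mulrzz mulrC.
  rewrite (bW _ bi) form_sum_l (big_nth p0) sW big_mkord.
  apply: eq_bigr => k _; rewrite mul_mx_diag !mxE (formC _ b`_j).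
  by ring.
have : 0 <= D ^+ m * \det (gram form b).
  rewrite -detZ DG !det_mulmx det_tr det_diag mulrAC -expr2.
  apply: mulr_ge0; first exact: sqr_ge0.
  by apply: prodr_ge0 => i _; rewrite mxE; apply: cW; rewrite mem_nth ?sW.
by rewrite pmulr_rge0 // exprn_gt0.
Qed.

(** The Smith form P diag(d) Q of the Gram matrix of a generating family [g] gives new generators
    [h] = P^-1 g with <h_i, g_j> = d_i Q_ij. By definiteness h_i = 0 when d_i = 0; the remaining
    ones are independent because Q is invertible. *)
Lemma lattice_has_rank : exists r, has_rank V r.
Proof.
have [m [g gP]] := lattice_fg latV.
have [P uP [Q uQ [d _ GE]]] := int_Smith_normal_form (gram form g).
pose h (i : 'I_m) : V := \sum_(k < m) g`_k *~ (invmx P) i k.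
have hg i (j : 'I_m) : form (h i) g`_j = d`_i * Q i j.
  rewrite form_sum_l.
  have /matrixP /(_ i j) : invmx P *m gram form g =
      (\matrix_(i, j) (d`_i *+ (i == j :> nat))) *m Q.
    by rewrite GE -mulmxA mulKmx.
  rewrite !mxE => E; transitivity (\sum_k invmx P i k * gram form g k j).
    by apply: eq_bigr => k _; rewrite mxE mulrC.
  rewrite E (bigD1 i) //= mxE eqxx mulr1n big1 ?addr0 // => k.
  rewrite -val_eqE eq_sym => /negPf /= ik.
  by rewrite mxE ik mulr0n mul0r.
have h0 (i : 'I_m) : d`_i = 0 -> h i = 0.
  move=> di; apply: lattice_eq0; have [a ha] := gP (h i).
  rewrite {2}ha form_sum_r big1 // => j _.
  by rewrite hg di !mul0r.
have hspan x : exists a : 'I_m -> int, x = \sum_i h i *~ a i.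
  have [a ->] := gP x; exists (fun i => ((\row_k a k) *m P) 0 i).
  under [RHS]eq_bigr do rewrite mulrz_suml.
  rewrite exchange_big /=; apply: eq_bigr => k _.
  under [RHS]eq_bigr do rewrite -mulrzA.
  rewrite -mulrz_sumr; congr (_ *~ _).
  have /rowP /(_ k) : (\row_k a k) *m P *m invmx P = \row_k a k by rewrite mulmxK.
  by rewrite mxE [RHS]mxE => <-; apply: eq_bigr => i _; rewrite mulrC.
pose I := [set i : 'I_m | d`_i != 0].
pose t := [tuple h (enum_val i) | i < #|I|].
have tE (i : 'I_#|I|) : t`_i = h (enum_val i) by rewrite nth_mktuple.
exists #|I|, t; split.
- move=> x; have [a ->] := hspan x; exists [ffun i => a (enum_val i)].
  rewrite (bigID (mem I)) /= [X in _ + X]big1 ?addr0; last first.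
    by move=> i; rewrite inE negbK => /eqP /h0 ->; rewrite mul0rz.
  rewrite big_enum_val; apply: eq_bigr => i _.
  by rewrite ffunE tE.
- move=> c c0.
  (* [c'] is the row of the c_k d_k, extended by zero to all indices; pairing the relation with
     every g_j says that [c' *m Q] vanishes. *)
  pose c' : 'rV[int]_m := \row_i \sum_(k < #|I| | enum_val k == i) c k * d`_i.
  have c'0 : c' = 0.
    suff : c' *m Q = 0 by move=> /(congr1 (mulmx^~ (invmx Q))); rewrite mulmxK // mul0mx.
    apply/rowP => j; rewrite mxE [RHS]mxE.
    have := congr1 (form^~ g`_j) c0.
    rewrite /= form_sum_l (morphD0 (formDl _)) => E; rewrite -[RHS]E.
    under eq_bigr do rewrite mxE mulr_suml.
    rewrite (exchange_big_dep xpredT) //=; apply: eq_bigr => k _.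
    rewrite (big_pred1 (enum_val k)) => [|i]; last by rewrite eq_sym.
    by rewrite tE hg; ring.
  move=> k; move/rowP/(_ (enum_val k)): c'0; rewrite !mxE.
  rewrite (big_pred1 k) => [/eqP|i /=]; last by rewrite (inj_eq enum_val_inj).
  have := enum_valP k; rewrite inE mulf_eq0 => /negPf ->.
  by rewrite orbF => /eqP.
Qed.

End LatticeTheory.

(** * The trace pairing and the involution of the ring [ZG] *)

Section ZGTheory.
Variable G : ugroup.

Local Notation u := (ug_u G).
Local Notation t := (@scaled_trace G).
Implicit Types (g : G) (z : ZG G).

Lemma scaled_traceD : {morph t : x y / x + y}.
Proof.
move=> x y; rewrite -[x]reprK -[y]reprK -raddfD /= !scaled_trace_pi.
by rewrite /gr_trace !ffunE opprD addrACA.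
Qed.

Lemma pi_ZG_sum (a : group_ring G) : \pi_(ZG G) a = \sum_g zg g *~ a g.
Proof.
have {1}-> : a = \sum_g gr_delta g *~ a g.
  apply/ffunP => h; rewrite sum_ffunE (bigD1 h) //= ffunMzE ffunE eqxx.
  rewrite intz big1 ?addr0 // => g gh.
  by rewrite ffunMzE ffunE eq_sym (negPf gh) mul0rz.
by rewrite raddf_sum; apply: eq_bigr => g _; rewrite -raddfMz.
Qed.

Lemma ZG_sum z : z = \sum_g zg g *~ repr z g.
Proof. by rewrite -[LHS]reprK pi_ZG_sum. Qed.

Lemma zgM g h : zg (g * h)%g = zg g * zg h.
Proof.
rewrite /zg -rmorphM /=; congr (\pi_(ZG G) _); apply/ffunP => k.
by rewrite gr_mul_delta !ffunE -(inj_eq (mulIg h^-1%g)) mulgK.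
Qed.

Lemma zg1 : zg 1%g = 1 :> ZG G.
Proof. by rewrite -(rmorph1 \pi_(ZG G)). Qed.

Lemma zgV g : zg g^-1%g * zg g = 1.
Proof. by rewrite -zgM mulVg zg1. Qed.

Lemma zg_u : zg u = -1.
Proof. by rewrite -[u]mulg1 zgu zg1. Qed.

Lemma ZG_eq_additive (W : zmodType) (f h : ZG G -> W) :
  {morph f : x y / x + y} -> {morph h : x y / x + y} ->
  (forall g, f (zg g) = h (zg g)) -> f =1 h.
Proof.
move=> fD hD fh z; rewrite (ZG_sum z) (morphD_sum fD) (morphD_sum hD).
by apply: eq_bigr => g _; rewrite (morphDMz fD) (morphDMz hD) fh.
Qed.

Lemma scaled_trace_zg g : t (zg g) = (g == 1%g)%:R - (g == u)%:R.
Proof. by rewrite scaled_trace_pi /gr_trace !ffunE ![g == _]eq_sym. Qed.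

Local Notation S := (transversal (rcosets <[u]>%g [set: G]) [set: G]).

(** Coset representatives form an orthonormal basis for the pairing t(conj(a) b): the trace of s^-1
    r is nonzero only if r is s or u s, that is, in the same coset, and every group element is a
    representative up to sign. *)
Lemma ZG_transversal_basis :
  {in S &, forall s r, t (zg s^-1%g * zg r) = (s == r)%:R} /\
  (forall z, z = \sum_(s in S) zg s *~ t (zg s^-1%g * z)).
Proof.
pose P := rcosets <[u]>%g [set: G].
have partP : partition P [set: G] by apply: rcosets_partition; apply: subsetT.
have trS := transversalP partP.
have cosetu g h : g \in (<[u]> :* h)%g -> g = h \/ g = (u * h)%g.
  case/rcosetP => x /cyclePmin [k]; rewrite ug_order.
  case: k => [|[|//]] _ -> ->.
    by left; rewrite expg0 mul1g.
  by right; rewrite expg1.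
have tst : {in S &, forall s r, t (zg s^-1%g * zg r) = (s == r)%:R}.
  move=> s r sS rS; rewrite -zgM scaled_trace_zg -eq_mulVg1.
  have [->|sr] := eqVneq s r.
    by rewrite mulVg eq_sym (negPf (u_neq1 G)) subr0.
  rewrite (_ : _ == u = false) ?subr0 //.
  apply/negP => /eqP sru; move/eqP: sr; apply; apply: (pblock_inj trS) => //.
  have rE : r = (u * s)%g by rewrite -sru ugC mulgA mulgV mul1g.
  have triv := partition_trivIset partP.
  have B : (<[u]> :* s)%g \in P by apply/rcosetsP; exists s; rewrite ?inE.
  rewrite (def_pblock triv B (rcoset_refl _ _)).
  rewrite (def_pblock triv B) // rE mem_rcoset mulgK.
  exact: cycle_id.
split=> // z.
have rD : {morph (fun z => \sum_(s in S) zg s *~ t (zg s^-1%g * z)) :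
    x y / x + y}.
  move=> x y; rewrite -big_split; apply: eq_bigr => s _.
  by rewrite mulrDr scaled_traceD mulrzDr.
apply: (ZG_eq_additive (f := fun z => z) _ rD) => {z} [x y //|g].
have gC : g \in cover P by rewrite (cover_partition partP) inE.
have PB : pblock P g \in P by rewrite pblock_mem.
have sB := repr_mem_pblock trS 1%g PB; set s := transversal_repr _ _ _ in sB.
have sS : s \in S by apply: (repr_mem_transversal trS).
have main : zg s = \sum_(r in S) zg r *~ t (zg r^-1%g * zg s).
  rewrite (bigD1 s) //= tst // eqxx big1 ?addr0 ?mulr1z // => r /andP [rS rs].
  by rewrite tst // (negPf rs).
have [->|->] : g = s \/ g = (u * s)%g; first last.
- rewrite zgu; rewrite {1}main -sumrN; apply: eq_bigr => r _.
  by rewrite mulrN (morphDN scaled_traceD) mulrNz.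
- by [].
case/rcosetsP: PB sB => h _ E; rewrite E => sB.
have gB : g \in (<[u]> :* h)%g by rewrite -E mem_pblock.
apply: cosetu; have [k [kU ->]] : exists k, k \in <[u]>%g /\ s = (k * h)%g.
  by case/rcosetP: sB => k; exists k.
by rewrite rcosetM (rcoset_id kU).
Qed.

Lemma ZG_basis : exists s : 'I_(#|G| %/ 2) -> G,
  (forall i j, t (zg (s i)^-1%g * zg (s j)) = (i == j)%:R) /\
  (forall z, z = \sum_i zg (s i) *~ t (zg (s i)^-1%g * z)).
Proof.
have [tS ES] := ZG_transversal_basis.
have partP : partition (rcosets <[u]>%g [set: G]) [set: G].
  by apply: rcosets_partition; apply: subsetT.
have cardS : #|S| = (#|G| %/ 2)%N.
  rewrite (card_transversal (transversalP partP)) -/(indexg _ _).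
  by rewrite -divgS ?subsetT // -orderE ug_order cardsT.
rewrite -cardS; exists (fun i => enum_val i); split=> [i j|z].
  by rewrite tS ?enum_valP // (inj_eq enum_val_inj).
by rewrite {1}(ES z) big_enum_val.
Qed.

Lemma scaled_trace_inj x y : (forall z, t (z * x) = t (z * y)) -> x = y.
Proof.
have [s [_ sE]] := ZG_basis.
by move=> xy; rewrite (sE x) (sE y); apply: eq_bigr => i _; rewrite xy.
Qed.

(** The trace pairing is perfect: the basis dual to (s_i) is (s_i^-1), and the representing element
    is the combination of the s_i^-1 with coefficients f(s_i). *)
Lemma scaled_trace_dual (f : ZG G -> int) :
  {morph f : x y / x + y} -> exists z0, forall z, t (z * z0) = f z.
Proof.
move=> fD; have [s [st sE]] := ZG_basis.
exists (\sum_i zg (s i)^-1%g *~ f (zg (s i))) => z.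
rewrite {2}(sE z) (morphD_sum fD) mulr_sumr (morphD_sum scaled_traceD).
apply: eq_bigr => i _; rewrite (morphDMz fD) mulrzAr.
by rewrite (morphDMz scaled_traceD) !mulrzz mulrC [z * _]mulrC.
Qed.

Definition ZG_conj z : ZG G := \sum_g zg g^-1%g *~ repr z g.

Lemma ZG_conj_pi (a : group_ring G) :
  ZG_conj (\pi_(ZG G) a) = \sum_g zg g^-1%g *~ a g.
Proof.
have FD (b c : group_ring G) : \sum_g zg g^-1%g *~ (b + c) g =
    \sum_g zg g^-1%g *~ b g + \sum_g zg g^-1%g *~ c g.
  by rewrite -big_split; apply: eq_bigr => g _; rewrite ffunE mulrzDr.
have : repr (\pi_(ZG G) a) - a \in @u1_ideal G by apply/pi_ZGP; rewrite reprK.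
move=> /u1_idealP [b E]; rewrite /ZG_conj -[repr _](subrK a) E.
(* After translation by u in the first sum, the contributions of b u and of b cancel termwise, since
   u becomes -1 in [ZG]. *)
rewrite FD mulrDr mulr1 FD [X in X + _ + _](reindex_inj (mulIg u)) /=.
rewrite -big_split /= big1 ?add0r // => g _.
rewrite gr_mul_delta mulgK invMg.
have -> : (u^-1 = u)%g by apply/eqP; rewrite eq_invg_mul uK.
by rewrite zgu mulNrz addNr.
Qed.

Lemma ZG_conjD : {morph ZG_conj : x y / x + y}.
Proof.
move=> x y; rewrite -[x]reprK -[y]reprK -raddfD /= !ZG_conj_pi -big_split.
by apply: eq_bigr => g _; rewrite ffunE mulrzDr.
Qed.

Lemma ZG_conj_zg g : ZG_conj (zg g) = zg g^-1%g.
Proof.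
rewrite ZG_conj_pi (bigD1 g) //= ffunE eqxx mulr1z big1 ?addr0 // => h hg.
by rewrite ffunE (negPf hg) mulr0z.
Qed.

Lemma ZG_conjM : {morph ZG_conj : x y / x * y}.
Proof.
move=> x y; move: x; apply: ZG_eq_additive.
- by move=> a b; rewrite mulrDl ZG_conjD.
- by move=> a b; rewrite ZG_conjD mulrDl.
move=> g; move: y; apply: ZG_eq_additive.
- by move=> a b; rewrite mulrDr ZG_conjD.
- by move=> a b; rewrite ZG_conjD mulrDr.
by move=> h; rewrite -zgM !ZG_conj_zg invMg zgM mulrC.
Qed.

Lemma ZG_conjK : involutive ZG_conj.
Proof.
apply: ZG_eq_additive => // [a b|g]; first by rewrite !ZG_conjD.
by rewrite !ZG_conj_zg invgK.
Qed.

Lemma scaled_trace_conj z : t (ZG_conj z) = t z.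
Proof.
move: z; apply: ZG_eq_additive => [a b||g]; last 1 first.
- rewrite ZG_conj_zg !scaled_trace_zg -(inj_eq invg_inj) invgK invg1.
  rewrite -(inj_eq invg_inj g^-1%g) invgK.
  by have -> : (u^-1 = u)%g by apply/eqP; rewrite eq_invg_mul uK.
- by rewrite ZG_conjD scaled_traceD.
- exact: scaled_traceD.
Qed.

End ZGTheory.

(** The algebra behind the rank one identity: with x = a e + M p and x' = b e + M q, and E, P, Q the
    pairings of e, p, q with y, the terms in E a b cancel and the rest is divisible by M. *)
Lemma exchange_mod (R : comNzRingType) (V : lmodType R) (e p q : V)
    (a b E P Q M : R) :
  (a * E + M * P) *: (b *: e + M *: q) - (b * E + M * Q) *: (a *: e + M *: p) =
  M *: ((P * b - Q * a) *: e + (a * E + M * P) *: q - (b * E + M * Q) *: p).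
Proof.
rewrite !(scalerDr, scalerA, scalerN) opprD addrACA -!scalerBl -addrA.
by congr (_ *: _ + (_ *: _ - _ *: _)); ring.
Qed.

(** * The lifted inner product, first in general, then on an invertible lattice *)

Section GLatticeTheory.
Variables (G : ugroup) (L : glattice G).

Local Notation t := (@scaled_trace G).
Implicit Types (x y : L) (z : ZG G).

Lemma ip_lattice : is_lattice (@ip G L).
Proof. by have [[fg Dl Dr C pos] _ _ _ _ _] := gl_ax L; split. Qed.

Lemma ipDl y : {morph (@ip G L)^~ y : x x' / x + x'}.
Proof. exact: lattice_formDl ip_lattice y. Qed.

Lemma ipDr x : {morph ip x : y y' / y + y'}.
Proof. exact: lattice_formDr ip_lattice x. Qed.

Lemma ipC x y : ip x y = ip y x.
Proof. exact: lattice_formC ip_lattice x y. Qed.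

Lemma ip_gact s x y : ip (gact s x) (gact s y) = ip x y.
Proof. exact: glattice_act_form (gl_ax L) s x y. Qed.

Lemma ip_adjoint z x y : ip (ZG_conj z *: x) y = ip x (z *: y).
Proof.
move: z; apply: ZG_eq_additive => [a b|a b|g].
- by rewrite ZG_conjD scalerDl ipDl.
- by rewrite scalerDl ipDr.
- by rewrite ZG_conj_zg !zg_scale -(ip_gact g) -gactM mulgV gact1.
Qed.

Definition hip x y : ZG G := lifted_ip x (conjv y).

(** After conjugating z and expanding it on the transversal, orthonormality extracts the coefficient
    <x, s y> of [hip x y] at each representative s. *)
Lemma scaled_trace_hip z x y : t (z * hip x y) = ip (z *: x) y.
Proof.
rewrite -[z]ZG_conjK; move: (ZG_conj z) => {}z; rewrite ip_adjoint.
have [tS ES] := ZG_transversal_basis G.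
rewrite (ES z) (morphD_sum (@ZG_conjD G)) mulr_suml scaler_suml.
rewrite (morphD_sum (@scaled_traceD G)) (morphD_sum (ipDr x)).
apply: eq_bigr => s sS; rewrite (morphDMz (@ZG_conjD G)) ZG_conj_zg mulrzAl.
rewrite (morphDMz (@scaled_traceD G)) -scalerMzl.
rewrite (morphDMz (ipDr x)); congr (_ *~ _).
rewrite /hip /lifted_ip /lifted_ip_on mulr_sumr.
rewrite (morphD_sum (@scaled_traceD G)) (bigD1 s) //= big1 ?addr0.
  rewrite mulrzAr (morphDMz (@scaled_traceD G)) tS // eqxx intz.
  by rewrite zg_scale.
move=> r /andP [rS rs]; rewrite mulrzAr (morphDMz (@scaled_traceD G)) tS //.
by rewrite eq_sym (negPf rs) mul0rz.
Qed.

Lemma scaled_trace_hip1 x y : t (hip x y) = ip x y.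
Proof. by rewrite -[hip _ _]mul1r scaled_trace_hip scale1r. Qed.

(** Nondegeneracy of the trace. Additivity, linearity and Hermitian symmetry of [hip] are obtained
    from those of the form through this criterion. *)
Lemma hip_unique x y (h : ZG G) : (forall z, t (z * h) = ip (z *: x) y) -> h = hip x y.
Proof. by move=> hE; apply: scaled_trace_inj => z; rewrite hE scaled_trace_hip. Qed.

Lemma hipDl y : {morph hip^~ y : x x' / x + x'}.
Proof.
move=> x x'; symmetry; apply: hip_unique => z.
by rewrite mulrDr scaled_traceD !scaled_trace_hip scalerDr ipDl.
Qed.

Lemma hipDr x : {morph hip x : y y' / y + y'}.
Proof.
move=> y y'; symmetry; apply: hip_unique => z.
by rewrite mulrDr scaled_traceD !scaled_trace_hip ipDr.
Qed.

Lemma hipZl z x y : hip (z *: x) y = z * hip x y.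
Proof.
symmetry; apply: hip_unique => z'.
by rewrite mulrA scaled_trace_hip scalerA.
Qed.

Lemma hip_conj x y : ZG_conj (hip x y) = hip y x.
Proof.
apply: hip_unique => z; rewrite -[z in LHS]ZG_conjK -ZG_conjM scaled_trace_conj.
by rewrite scaled_trace_hip ip_adjoint ipC.
Qed.

Lemma hipZr z x y : hip x (z *: y) = ZG_conj z * hip x y.
Proof. by rewrite -hip_conj hipZl ZG_conjM hip_conj. Qed.

(** The inverted action twists scalars by the involution, which is what makes the sesquilinear [hip]
    a bilinear [lifted_ip]. *)
Lemma conjv_scale z x : conjv (z *: x) = ZG_conj z *: conjv x.
Proof.
move: z; apply: ZG_eq_additive => [a b|a b|g].
- by rewrite scalerDl.
- by rewrite ZG_conjD scalerDl.
- by rewrite ZG_conj_zg !zg_scale /gact /= invgK.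
Qed.

Hypothesis invL : invertible L.

Lemma invertible_gen (m : nat) : (0 < m)%N ->
  exists e : L, forall x, exists z y, x = z *: e + y *+ m.
Proof.
case: invL => _ _ gen /gen [e eP]; exists e => x; have [c [y ->]] := eP x.
exists (\sum_s zg s *~ c s), y; congr (_ + _).
rewrite scaler_suml; apply: eq_bigr => s _.
by rewrite -scalerMzl zg_scale.
Qed.

(* The difference of the two sides is alternating in (x, x'), hence vanishes
   modulo m because L/mL is cyclic. *)
Lemma hip_exchange x y x' : hip x y *: x' = hip x' y *: x.
Proof.
apply/eqP; rewrite -subr_eq0; apply/eqP/(lattice_divisible_eq0 ip_lattice).
move=> m /invertible_gen [e eP].
have [a [p ->]] := eP x; have [b [q ->]] := eP x'.
rewrite !hipDl !hipZl !(morphDMn (hipDl y)) -[p *+ m]scaler_nat.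
rewrite -[q *+ m]scaler_nat -[hip p y *+ m]mulr_natl -[hip q y *+ m]mulr_natl.
by eexists; rewrite exchange_mod scaler_nat.
Qed.

(* The columns of the adjugate of the matrix of pairings (s_i e, b_j), where e
   generates L/mL, solve the linear system saying that hip e y is
   a scalar. *)
Lemma hip_scalar (m : nat) : (0 < m)%N ->
  exists (e y : L) (N k : int), hip e y = N%:~R /\ (m %| k * N - 1)%Z.
Proof.
move=> /invertible_gen [e eP]; have [[b' Zb'] [n [b [Zb detb]]] _] := invL.
have := zbasis_size Zb Zb' => nE; subst n; move: b b' Zb Zb' detb.
have [s [st sE]] := ZG_basis G; move: s st sE; set n := (#|G| %/ 2)%N.
move=> s st sE b _ Zb _ detb.
have /choice [zf /choice [yf bE]] :
  forall i : 'I_n, exists z y, b`_i = z *: e + y *+ m by move=> i; apply: eP.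
pose C : 'M[int]_n := \matrix_(i, j) t (zg (s j)^-1%g * zf i).
pose B : 'M[int]_n := \matrix_(i, j) ip (zg (s i) *: e) b`_j.
pose c := \adj B *m (\col_i t (zg (s i))).
exists e, (\sum_(j < n) b`_j *~ c j 0), (\det B), (\det C); split.
  symmetry; apply: hip_unique => z; rewrite mulrzr (morphDMz (@scaled_traceD G)).
  rewrite mulrzz {1}(sE z) (morphD_sum (@scaled_traceD G)) mulr_suml.
  rewrite {2}(sE z) scaler_suml (morphD_sum (ipDl _)); apply: eq_bigr => i _.
  rewrite -scalerMzl (morphDMz (ipDl _)) (morphDMz (@scaled_traceD G)) !mulrzz.
  rewrite mulrAC; congr (_ * _).
  have /colP /(_ i) : B *m c = \det B *: \col_i t (zg (s i)).
    by rewrite mulmxA mul_mx_adj mul_scalar_mx.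
  rewrite !mxE mulrC => <-; rewrite (morphD_sum (ipDr _)).
  by apply: eq_bigr => j _; rewrite (morphDMz (ipDr _)) mulrzz !mxE.
(* Modulo m each b_i equals z_i e, with coordinates in row i of [C], so the Gram matrix of [b], of
   determinant 1, is congruent to [C *m B]. *)
rewrite -det_mulmx -opprB rpredN -detb; apply: dvdz_sub_det => i j.
suff -> : gram (@ip G L) b i j - (C *m B) i j = ip (yf i) b`_j * m.
  exact: dvdz_mull.
apply/eqP; rewrite subr_eq addrC mxE {1}bE ipDl (morphDMn (ipDl _)) -mulr_natr.
rewrite natz; apply/eqP; congr (_ + _).
rewrite {1}(sE (zf i)) scaler_suml (morphD_sum (ipDl _)) mxE.
apply: eq_bigr => k _; rewrite -scalerMzl (morphDMz (ipDl _)) mulrzz !mxE.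
exact: mulrC.
Qed.

Lemma hip_unit : exists x1 y1 x2 y2 : L, hip x1 y1 + hip x2 y2 = 1.
Proof.
(* The modulus 2 only serves to make N1 odd, hence nonzero; the modulus |N1| then yields N2 prime to
   N1, and a Bezout relation ends the proof. *)
have [x1 [y1 [N1 [k1 [h1 d1]]]]] := hip_scalar (isT : 0 < 2)%N.
have N1_gt0 : (0 < `|N1|)%N.
  rewrite absz_gt0; apply: contraTneq d1 => ->.
  by rewrite mulr0 sub0r.
have [x2 [y2 [N2 [k2 [h2 /dvdzP [q d2]]]]]] := hip_scalar N1_gt0.
(* Chosen so that r N1 = - q |N1| = 1 - k2 N2. *)
pose r : int := - q * sgz N1.
exists (r%:~R *: x1), y1, (k2%:~R *: x2), y2.
rewrite !hipZl h1 h2 -!intrM -intrD.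
have -> // : r * N1 + k2 * N2 = 1.
have -> : k2 * N2 = 1 + (k2 * N2 - 1) by ring.
by rewrite d2 abszEsg /r; ring.
Qed.

Lemma half_order_gt0 : (0 < #|G| %/ 2)%N.
Proof.
rewrite divn_gt0 // -(ug_order G) orderE -cardsT.
exact: subset_leq_card (subsetT _).
Qed.

(** The orthogonal frame identity is applied to each s_i^-1 x, translated back by s_i and summed.
    The coefficients <s_i^-1 x, w> assemble into [hip x w *: w], which the rank one identity turns
    into [hip w w *: x]. *)
Lemma hip_frame : exists (D : int) (W : seq (int * L)),
  [/\ 0 < D, forall p, p \in W -> 0 <= p.1 &
      forall x : L, \sum_(p <- W) (hip p.2 p.2 *: x) *~ p.1 = x *~ D].
Proof.
have [[b Zb] _ _] := invL.
have [D [W [D0 _ cW bW]]] := orthogonal_frame ip_lattice b.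
have WE x : x *~ D = \sum_(p <- W) p.2 *~ (p.1 * ip x p.2).
  have [a ->] := Zb.1 x; rewrite mulrz_suml.
  under [RHS]eq_bigr do rewrite (form_sum_l ip_lattice) mulr_sumr mulrz_sumr.
  rewrite exchange_big /=; apply: eq_bigr => i _.
  have bi : b`_i \in (b : seq L) by rewrite mem_nth // size_tuple.
  rewrite -mulrzA mulrC mulrzA (bW _ bi) mulrz_suml; apply: eq_bigr => p _.
  by rewrite -mulrzA; congr (_ *~ _); ring.
(* The extra factor counts the coset representatives summed over. *)
exists ((#|G| %/ 2)%N%:Z * D), W; split=> // [|x].
  by rewrite mulr_gt0 // ltz_nat half_order_gt0.
have [s [_ sE]] := ZG_basis G.
transitivity (\sum_i gact (s i) (gact (s i)^-1%g x *~ D)); last first.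
  under eq_bigr do rewrite raddfMz /= -gactM mulgV gact1.
  by rewrite sumr_const card_ord mulrC mulrzA pmulrn.
under [RHS]eq_bigr do rewrite WE raddf_sum.
rewrite exchange_big /=; apply: eq_bigr => p _.
rewrite hip_exchange {1}(sE (hip x p.2)) scaler_suml mulrz_suml.
apply: eq_bigr => i _; rewrite raddfMz /= -scalerMzl zg_scale -mulrzA.
by rewrite scaled_trace_hip zg_scale mulrC.
Qed.

End GLatticeTheory.

(** * Additive maps out of the tensor product *)

Section TensorLift.
Variables (R : comNzRingType) (U V : lmodType R) (W : zmodType).

Lemma tensor_eq_additive (f h : tensor U V -> W) :
  {morph f : x y / x + y} -> {morph h : x y / x + y} ->
  (forall x v, f (tens x v) = h (tens x v)) -> f =1 h.
Proof.
move=> fD hD fh; elim/tensor_ind => [|a b fa fb|//].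
  by rewrite (morphD0 fD) (morphD0 hD).
by rewrite fD hD (morphDN fD) (morphDN hD) fa fb.
Qed.

Variable f : U -> V -> W.

Let flift : {freeg (U * V)%type / int} -> zmodule W :=
  fglift (fun p => (f p.1 p.2 : zmodule W)).

(** The universal property for balanced biadditive maps; balance makes the value independent of the
    representative. The target is a bare abelian group, so that semilinear maps such as [tensor_bar]
    are covered. *)
Definition tensor_lift (a : tensor U V) : W := flift (repr a).

Hypotheses (fDl : forall v, {morph f^~ v : x y / x + y})
           (fDr : forall x, {morph f x : v w / v + w})
           (fZ : forall a x v, f (a *: x) v = f x (a *: v)).

Let fliftB : {morph flift : a b / a - b}.
Proof. exact: lift_is_additive. Qed.

Let flift_gen x v : flift (fgen x v) = f x v.
Proof. by rewrite /flift /fgen liftU scale1r. Qed.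

Let flift_relators z : tensor_relators z -> flift z = 0.
Proof.
elim=> {z} [|z1 z2 _ h1 _ h2|x y v|x v w|b x v].
- by rewrite -(subrr 0) fliftB subrr.
- by rewrite fliftB h1 h2 subrr.
- by rewrite !fliftB !flift_gen fDl addrAC addrK subrr.
- by rewrite !fliftB !flift_gen fDr addrAC addrK subrr.
- by rewrite fliftB !flift_gen fZ subrr.
Qed.

Let tensor_lift_pi z : tensor_lift (\pi_(tensor U V) z) = flift z.
Proof.
apply/eqP; rewrite -subr_eq0 -[_ - _]fliftB; apply/eqP/flift_relators.
by apply/pi_tensorP; rewrite reprK.
Qed.

Lemma tensor_lift_tens x v : tensor_lift (tens x v) = f x v.
Proof. by rewrite tensor_lift_pi flift_gen. Qed.

Lemma tensor_liftD : {morph tensor_lift : a b / a + b}.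
Proof.
have B : zmod_morphism tensor_lift.
  move=> a b; rewrite -[a]reprK -[b]reprK -raddfB /= !tensor_lift_pi.
  exact: fliftB.
have := @GRing.isZmodMorphism.Build _ _ _ B => m.
exact: raddfD (HB.pack_for {additive tensor U V -> W} tensor_lift m).
Qed.

End TensorLift.

(** * Pure tensors and finite generation *)

Section TensorOps.
Variables (R : comNzRingType) (U V : lmodType R).

Lemma tensDl_morph (v : V) : {morph (@tens R U V)^~ v : x y / x + y}.
Proof. by move=> x y; apply: tensDl. Qed.

Lemma tensDr_morph (x : U) : {morph @tens R U V x : v w / v + w}.
Proof. by move=> v w; apply: tensDr. Qed.

Lemma tensZZ (a b : R) (x : U) (v : V) : tens (a *: x) (b *: v) = (a * b) *: tens x v.
Proof. by rewrite -tensZ scalerA mulrC tensZl. Qed.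

Lemma tensor_fg : finitely_generated U -> finitely_generated V ->
  finitely_generated (tensor U V).
Proof.
move=> [m [s sP]] [n [r rP]].
exists #|{: 'I_m * 'I_n}|, [tuple tens s`_(enum_val k).1 r`_(enum_val k).2
  | k < #|{: 'I_m * 'I_n}|].
set T := mktuple _.
have TE (k : 'I_#|{: 'I_m * 'I_n}|) :
  T`_k = tens s`_(enum_val k).1 r`_(enum_val k).2 by rewrite nth_mktuple.
elim/tensor_ind => [|a b [c ->] [d ->]|x v].
- by exists 0; rewrite big1 // => k _; rewrite ffunE mulr0z.
- exists (c - d); rewrite -sumrB; apply: eq_bigr => k _.
  by rewrite !ffunE mulrzBr.
have [c ->] := sP x; have [d ->] := rP v.
exists [ffun k => c (enum_val k).1 * d (enum_val k).2].
rewrite (morphD_sum (tensDl_morph _)).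
under eq_bigr do rewrite (morphDMz (tensDl_morph _)) (morphD_sum (tensDr_morph _)) mulrz_suml.
rewrite pair_big /= (reindex_onto (fun k : 'I_#|{: 'I_m * 'I_n}| => enum_val k) enum_rank) /=; last first.
  by move=> p _; rewrite enum_rankK.
apply: eq_big => [k|k _]; first by rewrite enum_valK eqxx.
by rewrite (morphDMz (tensDr_morph _)) TE ffunE -mulrzA mulrC.
Qed.

End TensorOps.

(** * The dot product and the conjugation on the tensor product *)

Section TensorDot.
Variables (G : ugroup) (L M : glattice G).

Local Notation t := (@scaled_trace G).
Local Notation T := (L *t M)%type.
Local Notation Tb := (conj_glattice L *t conj_glattice M)%type.

Lemma lifted_ipDl (K : glattice G) (y : conj_glattice K) :
  {morph (@lifted_ip G K)^~ y : x x' / x + x'}.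
Proof. exact: (@hipDl G K (unconjv y)). Qed.

Lemma lifted_ipDr (K : glattice G) (x : K) :
  {morph @lifted_ip G K x : y y' / y + y'}.
Proof. exact: (@hipDr G K x). Qed.

Lemma lifted_ipZl (K : glattice G) z (x : K) (y : conj_glattice K) :
  lifted_ip (z *: x) y = z * lifted_ip x y.
Proof. exact: (@hipZl G K z x (unconjv y)). Qed.

Lemma lifted_ipZr (K : glattice G) z (x : K) (y : conj_glattice K) :
  lifted_ip x (z *: y) = z * lifted_ip x y.
Proof.
have := hipZr (ZG_conj z) x (unconjv y).
by rewrite /hip conjv_scale ZG_conjK.
Qed.

(** First of two nested lifts: the second argument is frozen at a pure tensor, and [tensor_dot] then
    lifts in (y, w). *)
Definition tensor_dot_pure (y : conj_glattice L) (w : conj_glattice M) : T -> ZG G :=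
  tensor_lift (fun x v => lifted_ip x y * lifted_ip v w).

Lemma tensor_dot_pureD y w : {morph tensor_dot_pure y w : a b / a + b}.
Proof.
apply: tensor_liftD => [v x x'|x v v'|z x v].
- by rewrite lifted_ipDl mulrDl.
- by rewrite lifted_ipDl mulrDr.
- by rewrite !lifted_ipZl mulrCA mulrA.
Qed.

Lemma tensor_dot_pure_tens y w x v :
  tensor_dot_pure y w (tens x v) = lifted_ip x y * lifted_ip v w.
Proof.
apply: tensor_lift_tens => [v' x1 x2|x1 v1 v2|z x1 v1].
- by rewrite lifted_ipDl mulrDl.
- by rewrite lifted_ipDl mulrDr.
- by rewrite !lifted_ipZl mulrCA mulrA.
Qed.

Definition tensor_dot (a : T) : Tb -> ZG G :=
  tensor_lift (fun y w => tensor_dot_pure y w a).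

Let pureDl a w : {morph (fun y => tensor_dot_pure y w a) : y y' / y + y'}.
Proof.
move=> y y'; move: a; apply: tensor_eq_additive => [a b|a b|x v].
- exact: tensor_dot_pureD.
- by rewrite !tensor_dot_pureD addrACA.
- by rewrite !tensor_dot_pure_tens lifted_ipDr mulrDl.
Qed.

Let pureDr a y : {morph (fun w => tensor_dot_pure y w a) : w w' / w + w'}.
Proof.
move=> w w'; move: a; apply: tensor_eq_additive => [a b|a b|x v].
- exact: tensor_dot_pureD.
- by rewrite !tensor_dot_pureD addrACA.
- by rewrite !tensor_dot_pure_tens lifted_ipDr mulrDr.
Qed.

Let pureZ a z y w : tensor_dot_pure (z *: y) w a = tensor_dot_pure y (z *: w) a.
Proof.
move: a; apply: tensor_eq_additive => [a b|a b|x v].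
- exact: tensor_dot_pureD.
- exact: tensor_dot_pureD.
- by rewrite !tensor_dot_pure_tens !lifted_ipZr mulrCA mulrA.
Qed.

Lemma tensor_dot_tens x v y w :
  tensor_dot (tens x v) (tens y w) = lifted_ip x y * lifted_ip v w.
Proof.
by rewrite /tensor_dot tensor_lift_tens ?tensor_dot_pure_tens.
Qed.

Let tensor_dotEr a y w : tensor_dot a (tens y w) = tensor_dot_pure y w a.
Proof.
exact: tensor_lift_tens.
Qed.

Lemma tensor_dotDr a : {morph tensor_dot a : b c / b + c}.
Proof.
exact: tensor_liftD.
Qed.

Lemma tensor_dotDl b : {morph tensor_dot^~ b : a c / a + c}.
Proof.
move=> a c; move: b; apply: tensor_eq_additive => [b b'|b b'|y w].
- exact: tensor_dotDr.
- by rewrite !tensor_dotDr addrACA.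
- by rewrite !tensor_dotEr tensor_dot_pureD.
Qed.

Lemma tensor_dotZl z a b : tensor_dot (z *: a) b = z * tensor_dot a b.
Proof.
move: b; apply: tensor_eq_additive => [b c|b c|y w].
- exact: tensor_dotDr.
- by rewrite tensor_dotDr mulrDr.
move: a; apply: tensor_eq_additive => [a c|a c|x v].
- by rewrite scalerDr tensor_dotDl.
- by rewrite tensor_dotDl mulrDr.
- by rewrite tensZl !tensor_dot_tens lifted_ipZl mulrA.
Qed.

Lemma tensor_dotZr z a b : tensor_dot a (z *: b) = z * tensor_dot a b.
Proof.
move: b; apply: tensor_eq_additive => [b c|b c|y w].
- by rewrite scalerDr tensor_dotDr.
- by rewrite tensor_dotDr mulrDr.
move: a; apply: tensor_eq_additive => [a c|a c|x v].
- exact: tensor_dotDl.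
- by rewrite tensor_dotDl mulrDr.
- by rewrite tensZl !tensor_dot_tens lifted_ipZr mulrA.
Qed.

Lemma tensor_dotP : is_tensor_dot tensor_dot.
Proof.
split=> [b z a c|a z b c|x y v w].
- by rewrite tensor_dotDl tensor_dotZl.
- by rewrite tensor_dotDr tensor_dotZr.
- exact: tensor_dot_tens.
Qed.

Lemma tensor_dot_unique dot : is_tensor_dot dot -> dot =2 tensor_dot.
Proof.
move=> [linl linr dotE] a b.
have dotDl c : {morph dot^~ c : x y / x + y}.
  by move=> x y; have := linl c 1 x y; rewrite scale1r mul1r.
have dotDr c : {morph dot c : x y / x + y}.
  by move=> x y; have := linr c 1 x y; rewrite scale1r mul1r.
move: b; apply: tensor_eq_additive => [||y w]; first exact: dotDr.
  exact: tensor_dotDr.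
move: a; apply: tensor_eq_additive => [||x v]; first exact: dotDl.
  exact: tensor_dotDl.
by rewrite tensor_dot_tens; apply: dotE.
Qed.

Definition tensor_bar : T -> Tb :=
  tensor_lift (fun (x : L) (v : M) => tens (conjv x) (conjv v)).

Definition tensor_unbar : Tb -> T :=
  tensor_lift (fun (x : conj_glattice L) (v : conj_glattice M) =>
    tens (unconjv x) (unconjv v)).

Let barDl (v : M) : {morph (fun x : L => tens (conjv x) (conjv v) : Tb) : x y / x + y}.
Proof. by move=> x y; apply: (@tensDl _ (conj_glattice L) (conj_glattice M)). Qed.

Let barDr (x : L) : {morph (fun v : M => tens (conjv x) (conjv v) : Tb) : v w / v + w}.
Proof. by move=> v w; apply: (@tensDr _ (conj_glattice L) (conj_glattice M)). Qed.

Let barZ z (x : L) (v : M) :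
  tens (conjv (z *: x)) (conjv v) = tens (conjv x) (conjv (z *: v)) :> Tb.
Proof. by rewrite !conjv_scale tensZ. Qed.

Lemma tensor_bar_tens x v : tensor_bar (tens x v) = tens (conjv x) (conjv v).
Proof. exact: tensor_lift_tens. Qed.

Lemma tensor_barD : {morph tensor_bar : a b / a + b}.
Proof. exact: tensor_liftD. Qed.

Let unbarDl (v : conj_glattice M) :
  {morph (fun x : conj_glattice L => tens (unconjv x) (unconjv v) : T) : x y / x + y}.
Proof. by move=> x y; apply: (@tensDl _ L M). Qed.

Let unbarDr (x : conj_glattice L) :
  {morph (fun v : conj_glattice M => tens (unconjv x) (unconjv v) : T) : v w / v + w}.
Proof. by move=> v w; apply: (@tensDr _ L M). Qed.

Lemma unconjv_scale (K : glattice G) z (x : conj_glattice K) :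
  unconjv (z *: x) = ZG_conj z *: unconjv x.
Proof.
rewrite -{1}[z]ZG_conjK -[x in LHS]/(conjv (unconjv x)).
by rewrite -conjv_scale.
Qed.

Let unbarZ z (x : conj_glattice L) (v : conj_glattice M) :
  tens (unconjv (z *: x)) (unconjv v) = tens (unconjv x) (unconjv (z *: v)) :> T.
Proof. by rewrite !unconjv_scale tensZ. Qed.

Lemma tensor_unbar_tens x v : tensor_unbar (tens x v) = tens (unconjv x) (unconjv v).
Proof. exact: tensor_lift_tens. Qed.

Lemma tensor_unbarD : {morph tensor_unbar : a b / a + b}.
Proof. exact: tensor_liftD. Qed.

Lemma tensor_bar_bij : bijective tensor_bar.
Proof.
exists tensor_unbar; apply: tensor_eq_additive => //.
- by move=> a b; rewrite tensor_barD tensor_unbarD.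
- by move=> x v; rewrite tensor_bar_tens tensor_unbar_tens.
- by move=> a b; rewrite tensor_unbarD tensor_barD.
- by move=> x v; rewrite tensor_unbar_tens tensor_bar_tens.
Qed.

Lemma tensor_barP : is_tensor_conj tensor_bar.
Proof. by split; [exact: tensor_barD | exact: tensor_bar_tens]. Qed.

Lemma tensor_bar_unique bar : is_tensor_conj bar -> bar =1 tensor_bar.
Proof.
move=> [barD barE]; apply: tensor_eq_additive => //; first exact: tensor_barD.
by move=> x v; rewrite tensor_bar_tens barE.
Qed.

Lemma tensor_barZ z a : tensor_bar (z *: a) = ZG_conj z *: tensor_bar a.
Proof.
move: a; apply: tensor_eq_additive => [a b|a b|x v].
- by rewrite scalerDr tensor_barD.
- by rewrite tensor_barD scalerDr.
- by rewrite tensZl !tensor_bar_tens conjv_scale tensZl.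
Qed.

End TensorDot.

(** * The form on the tensor product of two invertible lattices *)

Section TensorInvertible.
Variables (G : ugroup) (L M : glattice G).

Local Notation t := (@scaled_trace G).
Local Notation T := (L *t M)%type.

Definition tensor_hip (a b : T) : ZG G := tensor_dot a (tensor_bar b).

Lemma tensor_hip_tens x v y w :
  tensor_hip (tens x v) (tens y w) = hip x y * hip v w.
Proof. by rewrite /tensor_hip tensor_bar_tens tensor_dot_tens. Qed.

Lemma tensor_hipDl b : {morph tensor_hip^~ b : a c / a + c}.
Proof. exact: tensor_dotDl. Qed.

Lemma tensor_hipDr a : {morph tensor_hip a : b c / b + c}.
Proof.
move=> b c; have E := congr1 (tensor_dot a) (tensor_barD b c).
exact: etrans E (tensor_dotDr a (tensor_bar b) (tensor_bar c)).
Qed.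

Lemma tensor_hipZl z a b : tensor_hip (z *: a) b = z * tensor_hip a b.
Proof. exact: tensor_dotZl. Qed.

Lemma tensor_hipZr z a b : tensor_hip a (z *: b) = ZG_conj z * tensor_hip a b.
Proof. by rewrite /tensor_hip tensor_barZ tensor_dotZr. Qed.

Lemma tensor_hip_conj a b : ZG_conj (tensor_hip a b) = tensor_hip b a.
Proof.
move: a; apply: tensor_eq_additive => [a c|a c|x v].
- by rewrite tensor_hipDl ZG_conjD.
- exact: tensor_hipDr.
move: b; apply: tensor_eq_additive => [b c|b c|y w].
- by rewrite tensor_hipDr ZG_conjD.
- exact: tensor_hipDl.
- by rewrite !tensor_hip_tens ZG_conjM !hip_conj.
Qed.

Definition tensor_ip (a b : T) : int := t (tensor_hip a b).

Lemma tensor_ipDl b : {morph tensor_ip^~ b : a c / a + c}.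
Proof. by move=> a c; rewrite /tensor_ip tensor_hipDl scaled_traceD. Qed.

Lemma tensor_ipDr a : {morph tensor_ip a : b c / b + c}.
Proof. by move=> b c; rewrite /tensor_ip tensor_hipDr scaled_traceD. Qed.

Lemma tensor_ipC a b : tensor_ip a b = tensor_ip b a.
Proof. by rewrite /tensor_ip -tensor_hip_conj scaled_trace_conj. Qed.

Definition contract (w : M) : T -> L :=
  tensor_lift (fun (x : L) (v : M) => hip v w *: x).

Let contr_Dl (w v : M) : {morph (fun x : L => hip v w *: x) : x y / x + y}.
Proof. by move=> x y; rewrite scalerDr. Qed.

Let contr_Dr (w : M) (x : L) : {morph (fun v : M => hip v w *: x) : v v' / v + v'}.
Proof. by move=> v v'; rewrite hipDl scalerDl. Qed.

Let contr_Z (w : M) z (x : L) (v : M) : hip v w *: (z *: x) = hip (z *: v) w *: x.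
Proof. by rewrite hipZl scalerA mulrC. Qed.

Lemma contract_tens w x v : contract w (tens x v) = hip v w *: x.
Proof. exact: tensor_lift_tens. Qed.

Lemma contractD w : {morph contract w : a b / a + b}.
Proof. exact: tensor_liftD. Qed.

Hypotheses (invL : invertible L) (invM : invertible M).

(** On a pure tensor the scalar [hip v y] moves across to [w], where the rank one identity of M
    exchanges v and w. *)
Lemma tens_contract y w a : tens (contract y a) w = hip w y *: a.
Proof.
move: a; apply: tensor_eq_additive => [a b|a b|x v].
- by rewrite contractD tensDl.
- by rewrite scalerDr.
- by rewrite contract_tens tensZ hip_exchange // -tensZ tensZl.
Qed.

(** On pure tensors this reduces to (v.w)(w.v') = (w.w)(v.v'), the rank one identity of M paired
    with v'. *)
Lemma hip_contract w a b :
  hip (contract w a) (contract w b) = hip w w * tensor_hip a b.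
Proof.
move: a; apply: tensor_eq_additive => [a c|a c|x v].
- by rewrite contractD hipDl.
- by rewrite tensor_hipDl mulrDr.
move: b; apply: tensor_eq_additive => [b c|b c|y v'].
- by rewrite contractD hipDr.
- by rewrite tensor_hipDr mulrDr.
rewrite !contract_tens tensor_hip_tens hipZl hipZr hip_conj.
have : hip v w * hip w v' = hip w w * hip v v' by rewrite -!hipZl hip_exchange.
by move=> E; rewrite mulrA E; ring.
Qed.

(** Writing 1 as a sum of two products x_i.y_i in M gives a as the sum of the tensors of
    [contract y_i a] with x_i. *)
Lemma contract_inj a : (forall w, contract w a = 0) -> a = 0.
Proof.
move=> a0; have [x1 [y1 [x2 [y2 xy]]]] := hip_unit invM.
rewrite -[a]scale1r -xy scalerDl -!tens_contract !a0.
by rewrite !(morphD0 (tensDl_morph _)) addr0.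
Qed.

Lemma tensor_torsion_free (a : T) (k : int) : k != 0 -> a *~ k = 0 -> a = 0.
Proof.
move=> k0 ak; apply: contract_inj => w.
apply: (lattice_torsion_free (ip_lattice L) k0).
by rewrite -(morphDMz (contractD w)) ak (morphD0 (contractD w)).
Qed.

Lemma tensor_ip_pos a : a != 0 -> 0 < tensor_ip a a.
Proof.
move=> a0; have [D [W [D0 cW WE]]] := hip_frame invM.
(* The frame identity of M, applied to the second factor of pure tensors, carries over to T. *)
have WT (b : T) : \sum_(p <- W) (hip p.2 p.2 *: b) *~ p.1 = b *~ D.
  move: b; apply: tensor_eq_additive => [b c|b c|x v].
  - by rewrite -big_split; apply: eq_bigr => p _; rewrite scalerDr mulrzDl.
  - by rewrite mulrzDl.
  rewrite -(morphDMz (tensDr_morph x)) -WE (morphD_sum (tensDr_morph x)).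
  by apply: eq_bigr => p _; rewrite (morphDMz (tensDr_morph x)) tensZl tensZ.
pose F (p : int * M) : int := p.1 * ip (contract p.2 a) (contract p.2 a).
have FE : D * tensor_ip a a = \sum_(p <- W) F p.
  rewrite mulrC -mulrzz -(morphDMz (tensor_ipDl a)) -WT.
  rewrite (morphD_sum (tensor_ipDl a)); apply: eq_bigr => p _.
  rewrite (morphDMz (tensor_ipDl a)) mulrzz mulrC /F; congr (_ * _).
  by rewrite -scaled_trace_hip1 hip_contract /tensor_ip tensor_hipZl.
have F0 p : p \in W -> 0 <= F p.
  by move=> /cW c0; rewrite mulr_ge0 // (lattice_ge0 (ip_lattice L)).
have S0 : 0 <= \sum_(p <- W) F p by rewrite big_seq sumr_ge0.
rewrite -(pmulr_rgt0 _ D0) FE lt_neqAle S0 andbT eq_sym; apply: contra a0.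
rewrite big_seq psumr_eq0 // => /allP Fz.
(* If all weighted squares vanish, then for each frame vector w either its weight or [contract w a]
   is zero. As (w.w) a is the tensor of that contraction with w, every term of D a vanishes. *)
apply/eqP/(tensor_torsion_free (lt0r_neq0 D0)); rewrite -WT big_seq big1 // => p pW.
have := Fz p pW; rewrite pW /= /F mulf_eq0 -tens_contract => /orP [/eqP ->|/eqP].
  by rewrite mulr0z.
move=> /(lattice_eq0 (ip_lattice L)) ->.
by rewrite (morphD0 (tensDl_morph _)) mul0rz.
Qed.

Lemma tensor_is_lattice : is_lattice tensor_ip.
Proof.
split; [|exact: tensor_ipDl|exact: tensor_ipDr|exact: tensor_ipC|exact: tensor_ip_pos].
by apply: tensor_fg; [exact: lattice_fg (ip_lattice L)
                     | exact: lattice_fg (ip_lattice M)].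
Qed.

Lemma tensor_is_glattice :
  is_glattice tensor_ip (fun (s : G) (a : T) => zg s *: a).
Proof.
split; first exact: tensor_is_lattice.
- by move=> s a b; rewrite scalerDr.
- move=> s a b; rewrite /tensor_ip tensor_hipZl tensor_hipZr ZG_conj_zg mulrA.
  by rewrite [zg s * _]mulrC zgV mul1r.
- by move=> a; rewrite zg1 scale1r.
- by move=> s r a; rewrite zgM scalerA.
- by move=> a; rewrite zg_u scaleN1r.
Qed.

Lemma tensor_gen (m : nat) : (0 < m)%N ->
  exists e : T, forall a, exists z b, a = z *: e + b *+ m.
Proof.
move=> m0; have [e eP] := invertible_gen invL m0.
have [f fP] := invertible_gen invM m0.
exists (tens e f); elim/tensor_ind.
- by exists 0, 0; rewrite scale0r mul0rn addr0.
- move=> _ _ [z1 [b1 ->]] [z2 [b2 ->]]; exists (z1 - z2), (b1 - b2).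
  by rewrite scalerBl mulrnBl opprD addrACA.
move=> x v; have [z1 [x1 ->]] := eP x; have [z2 [v2 ->]] := fP v.
exists (z1 * z2), (tens (z1 *: e) v2 + tens x1 (z2 *: f + v2 *+ m)).
rewrite tensDl [in LHS]tensDr (morphDMn (tensDr_morph _)).
rewrite (morphDMn (tensDl_morph _)) mulrnDl addrA; congr (_ + _ + _).
by rewrite -tensZ scalerA mulrC tensZl.
Qed.

(** A basis of some size r exists, and each inequality comes from a nonsingular product. For the
    upper bound, the basis is expressed modulo 2 by the translates of a single e, so the identity is
    congruent to [C *m P], whose determinant is odd. *)
Lemma tensor_has_rank : has_rank T (#|G| %/ 2).
Proof.
have [r [h Zh]] := lattice_has_rank tensor_is_lattice.
suff <- : r = (#|G| %/ 2)%N by exists h.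
have [crd [cD cE ch]] := zbasis_coord Zh; have [s [st sE]] := ZG_basis G.
apply/eqP; rewrite eqn_leq; apply/andP; split.
  have [e eP] := tensor_gen (isT : 0 < 2)%N.
  have /choice [zf /choice [yf hE]] :
    forall i : 'I_r, exists z y, h`_i = z *: e + y *+ 2 by move=> i; apply: eP.
  pose C : 'M[int]_(r, #|G| %/ 2) := \matrix_(i, k) t (zg (s k)^-1%g * zf i).
  pose P : 'M[int]_(#|G| %/ 2, r) := \matrix_(k, j) crd (zg (s k) *: e) 0 j.
  apply: (@det_mul_neq0_leq _ _ C P).
  have : (2 %| \det (1%:M : 'M[int]_r) - \det (C *m P))%Z.
    apply: dvdz_sub_det => i j.
    suff -> : (1%:M : 'M[int]_r) i j - (C *m P) i j = crd (yf i) 0 j * 2.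
      exact: dvdz_mull.
    apply/eqP; rewrite subr_eq addrC; apply/eqP; rewrite !mxE -ch hE cD mxE.
    rewrite {1}(sE (zf i)) scaler_suml (morphD_sum cD) summxE (morphDMn cD).
    congr (_ + _); last by rewrite mulr2n mxE; ring.
    apply: eq_bigr => k _; rewrite -scalerMzl (morphDMz cD) mxMzE !mxE.
    exact: mulrC.
  by rewrite det1; apply: contraTneq => ->.
(* Lower bound: as e.y and f.w are odd integers N and N', orthonormality of the s_i makes the
   translates of the tensors of e, f and of y, w dual to each other up to the nonzero factor N
   N'. *)
have [e [y [N [k [eyN dN]]]]] := hip_scalar invL (isT : 0 < 2)%N.
have [f [w [N' [k' [fwN dN']]]]] := hip_scalar invM (isT : 0 < 2)%N.
have odd_neq0 (a b : int) : (2 %| a * b - 1)%Z -> b != 0.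
  by apply: contraTneq => ->; rewrite mulr0 sub0r.
pose A : 'M[int]_(#|G| %/ 2, r) := \matrix_(i, j) crd (zg (s i) *: tens e f) 0 j.
pose B : 'M[int]_(r, #|G| %/ 2) :=
  \matrix_(i, j) tensor_ip h`_i (zg (s j) *: tens y w).
apply: (@det_mul_neq0_leq _ _ A B).
suff -> : A *m B = (N * N')%:M.
  by rewrite det_scalar expf_neq0 // mulf_neq0 ?(odd_neq0 _ _ dN) ?(odd_neq0 _ _ dN').
apply/matrixP => i j; rewrite mxE.
transitivity (tensor_ip (zg (s i) *: tens e f) (zg (s j) *: tens y w)).
  rewrite [in RHS](cE (zg (s i) *: tens e f)) (morphD_sum (tensor_ipDl _)).
  by apply: eq_bigr => l _; rewrite (morphDMz (tensor_ipDl _)) mulrzz !mxE mulrC.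
rewrite /tensor_ip tensor_hipZl tensor_hipZr ZG_conj_zg tensor_hip_tens eyN fwN.
rewrite -[N%:~R * _]intrM mulrA [zg (s i) * _]mulrC mulrzr.
by rewrite (morphDMz (@scaled_traceD G)) st mxE mulrzz mulr_natl eq_sym.
Qed.

(* With 1 = sum_k (x_k . y_k) = sum_l (v_l . w_l), the R-linear lift psi' of psi
   is represented by sum_(k, l) conj (psi' (x_k (x) v_l)) (y_k (x) w_l). *)
Lemma tensor_ip_dual (psi : T -> int) : {morph psi : a b / a + b} ->
  exists b, forall a, tensor_ip a b = psi a.
Proof.
move=> psiD.
have /choice [ps psP] : forall a, exists z0, forall z, t (z * z0) = psi (z *: a).
  move=> a; apply: (scaled_trace_dual (f := fun z => psi (z *: a))) => z1 z2.
  by rewrite scalerDl psiD.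
have psD : {morph ps : a b / a + b}.
  move=> a b; apply: scaled_trace_inj => z.
  by rewrite mulrDr scaled_traceD !psP scalerDr psiD.
have psZ z a : ps (z *: a) = z * ps a.
  by apply: scaled_trace_inj => z'; rewrite mulrA !psP scalerA.
have [x1 [y1 [x2 [y2 xy]]]] := hip_unit invL.
have [v1 [w1 [v2 [w2 vw]]]] := hip_unit invM.
pose q (x y : L) (v w : M) : T := ZG_conj (ps (tens x v)) *: tens y w.
have qE x y v w x' v' : tensor_hip (tens x' v') (q x y v w) =
    hip x y * hip v w * ps (tens x' v').
  (* By linearity of [ps] the scalars enter its argument, where the rank one identities replace x
     and v by x' and v'. *)
  rewrite tensor_hipZr ZG_conjK tensor_hip_tens mulrC -!psZ -!tensZZ.
  by rewrite (hip_exchange invL x') (hip_exchange invM v').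
exists (q x1 y1 v1 w1 + q x1 y1 v2 w2 + (q x2 y2 v1 w1 + q x2 y2 v2 w2)) => a.
rewrite -[a in RHS]scale1r -psP mul1r; congr t.
move: a; apply: tensor_eq_additive => [||x v]; [exact: tensor_hipDl | exact: psD|].
rewrite !tensor_hipDr !qE -!mulrDl -!mulrDr -mulrDl xy vw.
by rewrite !mul1r.
Qed.

(** Vectors representing the coordinate functionals give an integral right inverse of the Gram
    matrix, so its determinant is 1 or -1; positivity of the form excludes -1. *)
Lemma tensor_unimodular : unimodular tensor_ip.
Proof.
have [h Zh] := tensor_has_rank; exists (#|G| %/ 2)%N, h; split=> //.
have [crd [cD cE ch]] := zbasis_coord Zh.
have /choice [b bP] : forall i, exists b, forall a, tensor_ip a b = crd a 0 i.
  by move=> i; apply: tensor_ip_dual => x y; rewrite cD mxE.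
pose Q : 'M[int]_(#|G| %/ 2) := \matrix_(i, j) crd (b j) 0 i.
have GQ : gram tensor_ip h *m Q = 1%:M.
  apply/matrixP => i j; rewrite mxE [RHS]mxE -ch -bP [in RHS](cE (b j)).
  rewrite (morphD_sum (tensor_ipDr _)); apply: eq_bigr => k _.
  by rewrite (morphDMz (tensor_ipDr _)) mulrzz !mxE.
have unitG : \det (gram tensor_ip h) \is a GRing.unit.
  by apply/unitrPr; exists (\det Q); rewrite -det_mulmx GQ det1.
have := det_gram_ge0 tensor_is_lattice h; move: unitG.
by rewrite unfold_in /= => /orP [] /eqP ->.
Qed.

End TensorInvertible.

(** * The invertible tensor lattice and its lifted inner product *)

Theorem theorem13p3 (G : ugroup) (L M : glattice G) :
  invertible L -> invertible M ->
  exists (dot : (L *t M)%type ->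
                (conj_glattice L *t conj_glattice M)%type -> ZG G)
         (bar : (L *t M)%type -> (conj_glattice L *t conj_glattice M)%type),
  [/\ is_tensor_dot dot /\
        (forall dot', is_tensor_dot dot' -> dot' =2 dot),
      is_tensor_conj bar /\ (forall bar', is_tensor_conj bar' -> bar' =1 bar),
      bijective bar &
      exists glT : is_glattice
               (fun a b : (L *t M)%type => scaled_trace (dot a (bar b)))
               (fun (s : G) (a : (L *t M)%type) => zg s *: a),
        let T := GLattice glT in
        invertible T /\
        forall a b : T, dot a (bar b) = lifted_ip a (conjv b)].
Proof.
move=> invL invM; exists (@tensor_dot G L M), (@tensor_bar G L M).
split; [split; [exact: tensor_dotP | exact: tensor_dot_unique]
       |split; [exact: tensor_barP | exact: tensor_bar_unique]
       |exact: tensor_bar_bij|].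
exists (tensor_is_glattice L invM) => T; split.
  split; [exact: tensor_has_rank | exact: tensor_unimodular |].
  move=> m /(tensor_gen invL invM) [e eP]; exists e => a.
  (* A representative of z in the group ring supplies the integer coefficients of the translates of
     e. *)
  have [z [b ->]] := eP a; exists (repr z), b.
  by rewrite {1}(ZG_sum z) scaler_suml; congr (_ + _); apply: eq_bigr => s _;
     rewrite -scalerMzl.
(* Reduction to group elements reconciles the scaling that T receives as a lattice with the one of
   the tensor product: both agree there with the action. *)
move=> a b; apply: (@hip_unique G T); apply: ZG_eq_additive => [z z'|z z'|g].
- by rewrite mulrDl scaled_traceD.
- by rewrite scalerDl ipDl.
- by rewrite zg_scale -tensor_dotZl.
Qed.
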